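(* Let $\nu$ be a norm on $\mathbb{R}^2$. Then $c_\nu$ is an accumulation point of the Dirichlet spectrum $\mathbb{D}_\nu=\{c_\nu(\mathbf{x}):\mathbf{x}\in\mathbb{R}^2\}\subset\mathbb{R}$.
   Context: For a norm $\nu$ on $\mathbb{R}^2$, let $\operatorname{dist}_\nu$ be the distance function induced by $\nu$, so $\operatorname{dist}_\nu(\mathbf{y},\mathbb{Z}^2)=\min_{\mathbf{p}\in\mathbb{Z}^2}\nu(\mathbf{y}-\mathbf{p})$. For $\mathbf{x}\in\mathbb{R}^2$ define $$c_\nu(\mathbf{x})=\limsup_{t\to\infty}\ t\cdot\Big(\min_{1\le q\le t}\operatorname{dist}_\nu(q\mathbf{x},\mathbb{Z}^2)\Big)^2,\qquad c_\nu=\sup_{\mathbf{x}\in\mathbb{R}^2}c_\nu(\mathbf{x}),$$ where $q$ ranges over integers and $t$ over real numbers. *)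

(* Defs.v *)
From mathcomp Require Import all_boot all_order all_algebra.
From mathcomp Require Import all_classical all_reals all_analysis.

Set Implicit Arguments.
Unset Strict Implicit.
Unset Printing Implicit Defensive.

Import Order.TTheory GRing.Theory Num.Theory.
Import numFieldNormedType.Exports.

Local Open Scope classical_set_scope.
Local Open Scope ring_scope.

(* The norm is a bare function with its axioms rather than a normedModType
   instance, since 'rV[R]_2 already carries the sup norm canonically.
   Nonnegativity follows from the axioms. *)
Record is_norm (R : realType) (nu : 'rV[R]_2 -> R) : Prop := IsNorm {
  norm_eq0 : forall v, nu v = 0 -> v = 0 ;
  norm_scale : forall (a : R) v, nu (a *: v) = `|a| * nu v ;
  norm_triangle : forall v w, nu (v + w) <= nu v + nu w }.

Section DirichletSpectrum.
Context (R : realType) (nu : 'rV[R]_2 -> R).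

(* For a norm the infimum is attained, Z^2 being discrete and closed. *)
Definition dist_Z2 (y : 'rV[R]_2) : R :=
  inf [set nu (y - map_mx intr p) | p in [set: 'rV[int]_2]].

(* The infimum of a finite set, nonempty as soon as 1 <= t; for t < 1 it is
   the infimum of the empty set, which is irrelevant to the limit t --> +oo. *)
Definition min_dist (x : 'rV[R]_2) (t : R) : R :=
  inf [set dist_Z2 (q%:R *: x) | q in [set q : nat | (1 <= q)%N /\ q%:R <= t]].

Definition dirichlet_const (x : 'rV[R]_2) : \bar R :=
  limf_esup (fun t : R => (t * min_dist x t ^+ 2)%:E) (pinfty_nbhs R).

Definition dirichlet_sup : \bar R :=
  ereal_sup [set dirichlet_const x | x in [set: 'rV[R]_2]].

(* As a set of reals; the values dirichlet_const x are nonnegative, so none is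
   lost when dirichlet_sup is finite. *)
Definition dirichlet_spectrum : set R :=
  [set c | exists x : 'rV[R]_2, dirichlet_const x = c%:E].

End DirichletSpectrum.

(* Main.v *)
Require Import Defs.
From mathcomp Require Import all_boot all_order all_algebra.
From mathcomp Require Import all_classical all_reals all_analysis.
From mathcomp Require Import ring lra zify.
Import Order.TTheory GRing.Theory Num.Theory.
Import numFieldNormedType.Exports.
Local Open Scope classical_set_scope.
Local Open Scope ring_scope.

(** Every value of the function t * (min_(q <= t) dist (q x, Z^2))^2 that lies
below the supremum c can be reproduced as the limsup of another point, up to an
arbitrarily small error. So the spectrum meets each interval (c - e, c), and c
is an accumulation point of it whether or not c itself is attained. Nothing has
to be known about the value of c beyond 0 < c < +oo, which is Dirichlet's
theorem together with one trivial example.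

The mechanism takes place in the lattice of the vectors (q x - p, q) of R^2 x R:
the function above at t is governed by the vectors of height at most t whose
horizontal part is short.

- Models. A rational point (a1, a2) / D yields a lattice whose vectors have
  horizontal part v = (m1 + m3 a1 / D, m2 + m3 a2 / D) and height m3. Stretching
  the second coordinate of v by s >= 1 gives a one-parameter family. For s = 1,
  and for a rational point very close to a nearly optimal one, the value of the
  model is close to c. When s grows the value tends to 0, the vector (1, 0)
  becoming relatively too short; and it varies slowly, since multiplying s by
  1 + h changes all norms by a factor 1 + O(h). Hence some s gives a value in
  any prescribed interval below c ([exists_deep_shallow]).

- Transplantation. Near every rational point r there are rational points r'
  whose lattice, between the heights den r and den r', is a rescaled copy of a
  given model up to a small relative error ([transplant] for the arithmetic,
  [approximating_lattice] for the estimates). At the heights that are small in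
  the rescaled copy, the multiple den r of r' is already very close to Z^2. So
  the maximum of the function of r' on the window [den r, den r'] is close to
  the value of the model ([window_step]).

- Nesting. Iterating with rapidly decreasing distances, the limit point sees
  all the windows, and its limsup is within the prescribed interval
  ([nested_windows], [spectrum_between]). *)

(** * Norms of the plane in coordinates *)

Definition pt {R : realType} (a b : R) : 'rV[R]_2 :=
  \row_i (if i == 0 then a else b).

Section PlaneNorm.
Context {R : realType} {nu : 'rV[R]_2 -> R} (nu_norm : is_norm nu).
Implicit Types a b c d : R.

Lemma ptE (v : 'rV[R]_2) : v = pt (v 0 0) (v 0 1).
Proof.
apply/rowP => i; rewrite mxE; case: i => [[|[|//]] i]; rewrite /=.
  by congr (v _ _); apply/val_inj.
by congr (v _ _); apply/val_inj.
Qed.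

Lemma ptD a b c d : pt a b + pt c d = pt (a + c) (b + d).
Proof. by apply/rowP => i; rewrite !mxE; case: ifP. Qed.

Lemma ptZ c a b : c *: pt a b = pt (c * a) (c * b).
Proof. by apply/rowP => i; rewrite !mxE; case: ifP. Qed.

Lemma ptN a b : - pt a b = pt (- a) (- b).
Proof. by rewrite -scaleN1r ptZ !mulN1r. Qed.

Lemma norm_triangle2 a b c d :
  nu (pt (a + c) (b + d)) <= nu (pt a b) + nu (pt c d).
Proof. by rewrite -ptD; exact: norm_triangle. Qed.

Lemma norm_scale2 c a b : nu (pt (c * a) (c * b)) = `|c| * nu (pt a b).
Proof. by rewrite -ptZ; exact: norm_scale. Qed.

Lemma norm_oppr2 a b : nu (pt (- a) (- b)) = nu (pt a b).
Proof. by rewrite -[- a]mulN1r -[- b]mulN1r norm_scale2 normrN1 mul1r. Qed.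

Lemma norm_0 : nu (pt 0 0) = 0.
Proof. by rewrite -[X in pt X _](mul0r 0) -[X in pt _ X](mul0r 0) norm_scale2 normr0 mul0r. Qed.

Lemma norm_ge0 a b : 0 <= nu (pt a b).
Proof.
have := norm_triangle2 a b (- a) (- b).
by rewrite !subrr norm_0 norm_oppr2 -mulr2n pmulrn_lge0.
Qed.

Lemma norm_le_sub a b c d :
  nu (pt a b) <= nu (pt c d) + nu (pt (a - c) (b - d)).
Proof. by have := norm_triangle2 c d (a - c) (b - d); rewrite !subrKC. Qed.

Lemma norm_le_coord a b :
  nu (pt a b) <= `|a| * nu (pt 1 0) + `|b| * nu (pt 0 1).
Proof.
rewrite -!norm_scale2 !mulr1 !mulr0.
by have := norm_triangle2 a 0 0 b; rewrite addr0 add0r.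
Qed.

Lemma norm_pt_gt0 a b : a != 0 \/ b != 0 -> 0 < nu (pt a b).
Proof.
move=> ab; rewrite lt_neqAle norm_ge0 andbT eq_sym; apply/eqP => /(norm_eq0 nu_norm)/rowP e.
by case: ab => /eqP; apply; [have := e 0|have := e 1]; rewrite !mxE.
Qed.

Lemma norm_line_cont (p q : R * R) :
  continuous (fun t : R => nu (pt (p.1 + t * q.1) (p.2 + t * q.2))).
Proof.
move=> t; apply/cvgrPdist_le => e e0.
have K0 : 0 < nu (pt q.1 q.2) + 1 by rewrite ltr_wpDl ?norm_ge0.
near=> u.
have H : `|t - u| * nu (pt q.1 q.2) <= e.
  apply: (@le_trans _ _ (e / (nu (pt q.1 q.2) + 1) * (nu (pt q.1 q.2) + 1))).
    apply: ler_pM => //; first exact: norm_ge0.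
      by near: u; apply: cvgr_dist_le => //; rewrite divr_gt0.
    by rewrite lerDl.
  by rewrite divfK// gt_eqF.
rewrite ler_norml; apply/andP; split.
  rewrite lerNl opprB lerBlDr (le_trans (norm_le_sub _ _ (p.1 + t * q.1) (p.2 + t * q.2)))//.
  rewrite addrC lerD2r (le_trans _ H)//.
  rewrite -normrN -norm_scale2 opprB.
  by rewrite le_eqVlt; apply/orP; left; apply/eqP; congr (nu (pt _ _)); ring.
rewrite lerBlDr (le_trans (norm_le_sub _ _ (p.1 + u * q.1) (p.2 + u * q.2)))//.
rewrite addrC lerD2r (le_trans _ H)//.
rewrite -norm_scale2.
by rewrite le_eqVlt; apply/orP; left; apply/eqP; congr (nu (pt _ _)); ring.
Unshelve. all: by end_near. Qed.

(** After division by the larger coordinate the vector lies on a side of the unit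
square, where the continuous function nu has a positive minimum. *)
Lemma norm_ge_coord :
  exists2 k : R, 0 < k & forall a b, k * (`|a| + `|b|) <= nu (pt a b).
Proof.
have le11 : -1 <= 1 :> R by lra.
have [c1 _ H1] := EVT_min le11
  (continuous_subspaceT (norm_line_cont (1, 0) (0, 1))).
have [c2 _ H2] := EVT_min le11
  (continuous_subspaceT (norm_line_cont (0, 1) (1, 0))).
set m1 := nu _ in H1; set m2 := nu _ in H2.
have m10 : 0 < m1 by apply: norm_pt_gt0; left; rewrite /= mulr0 addr0 oner_neq0.
have m20 : 0 < m2 by apply: norm_pt_gt0; right; rewrite /= mulr0 addr0 oner_neq0.
have m0 : 0 < Order.min m1 m2 by rewrite lt_min m10.
exists (Order.min m1 m2 / 2) => [|a b]; first by rewrite divr_gt0.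
have [ba|ab] := leP `|b| `|a|.
  have [a0|a0] := eqVneq a 0.
    have b0 : b = 0 by apply/eqP; rewrite -normr_le0 (le_trans ba)// a0 normr0.
    by rewrite a0 b0 normr0 addr0 mulr0 norm_ge0.
  have /H1 : b / a \in `[-1, 1].
    by rewrite in_itv /= -ler_norml normrM normfV ler_pdivrMr ?normr_gt0// mul1r.
  rewrite /= mulr0 mulr1 addr0 add0r => H.
  have -> : nu (pt a b) = `|a| * nu (pt 1 (b / a)).
    by rewrite -norm_scale2 mulr1 mulrCA mulfV// mulr1.
  have : Order.min m1 m2 * `|a| <= `|a| * nu (pt 1 (b / a)).
    rewrite mulrC ler_wpM2l// (le_trans _ H)// ge_min lexx//.
  nra.
have b0 : b != 0 by rewrite -normr_gt0 (le_lt_trans _ ab).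
have /H2 : a / b \in `[-1, 1].
  by rewrite in_itv /= -ler_norml normrM normfV ler_pdivrMr ?normr_gt0// mul1r ltW.
rewrite /= mulr0 mulr1 addr0 add0r => H.
have -> : nu (pt a b) = `|b| * nu (pt (a / b) 1).
  by rewrite -norm_scale2 mulr1 mulrCA mulfV// mulr1.
have : Order.min m1 m2 * `|b| <= `|b| * nu (pt (a / b) 1).
  rewrite mulrC ler_wpM2l// (le_trans _ H)// ge_min lexx orbT//.
nra.
Qed.

End PlaneNorm.

(** * The Dirichlet constant through individual integer points *)

Section DirichletConst.
Context {R : realType} {nu : 'rV[R]_2 -> R} (nu_norm : is_norm nu).
Implicit Types (x y t c : R) (q p : int).

Definition err (nu : 'rV[R]_2 -> R) x y q p1 p2 : R :=
  nu (pt (q%:~R * x - p1%:~R) (q%:~R * y - p2%:~R)).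

Lemma err_ge0 x y q p1 p2 : 0 <= err nu x y q p1 p2.
Proof. exact: norm_ge0. Qed.

Lemma err_dist (k : nat) x y (p : 'rV[int]_2) :
  nu (k%:R *: pt x y - map_mx intr p) = err nu x y k (p 0 0) (p 0 1).
Proof. by rewrite [map_mx _ _]ptE !mxE ptZ ptN ptD. Qed.

Lemma dist_Z2_le (k : nat) x y p1 p2 :
  dist_Z2 nu (k%:R *: pt x y) <= err nu x y k p1 p2.
Proof.
apply: ge_inf.
  exists 0 => _ /= [p _ <-]; rewrite err_dist; exact: err_ge0.
exists (\row_i (if i == 0 then p1 else p2)) => //.
by rewrite err_dist !mxE.
Qed.

Lemma le_dist_Z2 (k : nat) x y c :
  (forall p1 p2, c <= err nu x y k p1 p2) -> c <= dist_Z2 nu (k%:R *: pt x y).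
Proof.
move=> H; apply: lb_le_inf; first by eexists; exists 0.
by move=> _ /= [p _ <-]; rewrite err_dist.
Qed.

Lemma min_dist_le x y t q p1 p2 : 0 < q -> q%:~R <= t ->
  min_dist nu (pt x y) t <= err nu x y q p1 p2.
Proof.
case: q => // k k0 kt.
apply: (le_trans _ (dist_Z2_le k x y p1 p2)); apply: ge_inf.
  by exists 0 => _ /= [i _ <-]; apply: le_dist_Z2 => *; exact: err_ge0.
by exists k.
Qed.

Lemma le_min_dist x y t c : 1 <= t ->
  (forall q p1 p2, 0 < q -> q%:~R <= t -> c <= err nu x y q p1 p2) ->
  c <= min_dist nu (pt x y) t.
Proof.
move=> t1 H; apply: lb_le_inf; first by eexists; exists 1%N.
by move=> _ /= [k [k1 kt] <-]; apply: le_dist_Z2 => p1 p2; apply: H.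
Qed.

Lemma min_dist_ge0 x y t : 1 <= t -> 0 <= min_dist nu (pt x y) t.
Proof. by move=> t1; apply: le_min_dist => // *; exact: err_ge0. Qed.

Lemma dirichlet_const_le v c T :
  (forall t, T <= t -> t * min_dist nu v t ^+ 2 <= c) ->
  (dirichlet_const nu v <= c%:E)%E.
Proof.
move=> H; apply: (@le_trans _ _ (ereal_sup
    ((fun t : R => (t * min_dist nu v t ^+ 2)%:E) @` [set t | T <= t]))).
  apply: ereal_inf_lbound; exists [set t | T <= t] => //.
  by apply: nbhs_pinfty_ge; rewrite num_real.
by apply: ge_ereal_sup => _ /= [t Tt <-]; rewrite lee_fin H.
Qed.

Lemma le_dirichlet_const v c :
  (forall T, exists2 t, T < t & c <= t * min_dist nu v t ^+ 2) ->
  (c%:E <= dirichlet_const nu v)%E.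
Proof.
move=> H; apply: le_ereal_inf_tmp => _ /= [V [T [_ TV]] <-].
have [t Tt ct] := H T.
apply: (@le_trans _ _ (t * min_dist nu v t ^+ 2)%:E); first by rewrite lee_fin.
by apply: ereal_sup_ubound; exists t => //; exact: TV.
Qed.

Lemma dirichlet_const_gt v c T : (c%:E < dirichlet_const nu v)%E ->
  exists2 t, T < t & c < t * min_dist nu v t ^+ 2.
Proof.
move=> H; apply: contrapT => nex; move: H; rewrite ltNge => /negP; apply.
apply: (@dirichlet_const_le v c (T + 1)) => t Tt; rewrite leNgt; apply/negP => ct.
by apply: nex; exists t => //; apply: (lt_le_trans _ Tt); rewrite ltrDl.
Qed.

End DirichletConst.

(** * Transplanting a lattice near a rational point *)

Lemma int_multiple_near (R : realType) (a : R) (b : R) : 0 < b ->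
  exists m : int, a <= b * m%:~R < a + b.
Proof.
move=> b0; exists (Num.ceil (a / b)).
have /andP[H1 H2] := ceil_itv (a / b).
apply/andP; split; first by rewrite mulrC -ler_pdivrMr.
move: H1; rewrite intrD ltr_pdivlMr//; lra.
Qed.

(** The Bezout coefficients certify that the second numerator is prime to the
denominator. Then (1, 0) is primitive in the group Z^2 + Z x, which is what
makes the explicit basis used in [transplant] available. *)
Record rational_pt := RationalPt {
  den : int; num1 : int; num2 : int; bez1 : int; bez2 : int }.

Definition reduced (a : rational_pt) :=
  0 < den a /\ bez1 a * num2 a - den a * bez2 a = 1.

Definition xcoord {R : realType} (a : rational_pt) : R := (num1 a)%:~R / (den a)%:~R.
Definition ycoord {R : realType} (a : rational_pt) : R := (num2 a)%:~R / (den a)%:~R.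

Section Lattice.
Context {R : realType}.
Context (D a1 a2 : int).

(** The two coordinates of the element (m1, m2) + m3 (a1, a2) / D of the group
generated by Z^2 and (a1, a2) / D. *)
Definition lat1 (m1 m3 : int) : R := m1%:~R + m3%:~R * a1%:~R / D%:~R.
Definition lat2 (m2 m3 : int) : R := m2%:~R + m3%:~R * a2%:~R / D%:~R.

End Lattice.

Lemma frac_sub (R : realType) (N P c d h : int) : 0 < N -> 0 < P ->
  c * N = d * P - h ->
  c%:~R / P%:~R = d%:~R / N%:~R - h%:~R / (N%:~R * P%:~R) :> R.
Proof.
move=> N0 P0 cd; have -> : h = d * P - c * N by rewrite cd; ring.
by rewrite intrB !intrM; field; rewrite !intr_eq0 !gt_eqF.
Qed.

Section Transplant.
Context {R : realType}.
Context (D a1 a2 : int).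
Implicit Types (r : rational_pt) (q n m X e : int).

(** The dictionary between the lattice of r' and the model: the multiple q of r',
translated by (p1, p2), corresponds to the model vector (m1, m2, m3). The height
of the model is scaled by den r' / D and sheared by a term that is negligible
when n is large, and the horizontal part undergoes the linear map of matrix
-(X, -e; D, n D) / den r'. *)
Definition transported r (r' : rational_pt) n X e (q p1 p2 m1 m2 m3 : int) :=
  let v1 : R := lat1 D a1 m1 m3 in let v2 : R := lat2 D a2 m2 m3 in
  [/\ q%:~R = (den r')%:~R / D%:~R * m3%:~R + (den r)%:~R * (v1 + n%:~R * v2) :> R,
      q%:~R * xcoord r' - p1%:~R = - ((X%:~R * v1 - e%:~R * v2) / (den r')%:~R) :> R &
      q%:~R * ycoord r' - p2%:~R =
        - (D%:~R * (v1 + n%:~R * v2) / (den r')%:~R) :> R].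

(** Complete V = (num r, den r) to a basis V, u, u' of Z^3, where u stands for the
point (1, 0) of Z^2, and replace it with V, U = u + n V, T = u' + a V + b u. The
new point r' is the direction of D T - a1 V - a2 U, so that for it the relation
D T = a1 V + a2 U holds horizontally: V and U play the role of the unit vectors
of the model and T that of (a1, a2) / D. Given n, the free integers b and a
serve to adjust X and e, which then determine the linear map between the two
lattices; the inequalities on X and e make n times this map tend to the diagonal
matrix (1, s), up to sign, when n tends to infinity. *)
Lemma transplant r (u w n : int) (s : R) :
  reduced r -> 0 < D -> u * a1 + w * D = 1 -> 1 <= s -> 0 < n ->
  exists r' X e,
  [/\ [/\ n%:~R * D%:~R / s <= X%:~R :> R,
      X%:~R < n%:~R * D%:~R / s + (den r)%:~R * D%:~R :> R,
      0 <= e < den r * D & den r' = n * X + e],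
      (D %| n)%Z -> reduced r',
      xcoord r' = xcoord r - X%:~R / ((den r)%:~R * (den r')%:~R) :> R /\
      ycoord r' = ycoord r - D%:~R / ((den r)%:~R * (den r')%:~R) :> R,
      forall m1 m2 m3, exists q p1 p2, transported r r' n X e q p1 p2 m1 m2 m3 &
      forall q p1 p2, exists m1 m2 m3, transported r r' n X e q p1 p2 m1 m2 m3].
Proof.
case: r => N p1 p2 k l [/= N0 kl] D0 uw s1 n0.
have NR : 0 < N%:~R :> R by rewrite ltr0z.
have DR : 0 < D%:~R :> R by rewrite ltr0z.
have nR : 0 < n%:~R :> R by rewrite ltr0z.
have s0 : 0 < s by lra.
have ND : 0 < N%:~R * D%:~R :> R by rewrite mulr_gt0.
have [b /andP[b1 b2]] := @int_multiple_near R
  (n%:~R * D%:~R / s - (p1 * D * k - N * a2)%:~R) _ ND.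
pose X := p1 * D * k + N * (D * b - a2).
have [a /andP[e1 e2]] := @int_multiple_near R
  ((n * X - (D * k - N * (a1 + a2 * n)))%:~R) _ ND.
pose M := D * a - a1 - a2 * n.
pose N' := D * k + N * M.
pose e := N' - n * X.
pose q1 := M * p1 - D * b + a2.
pose q2 := D * l + p2 * M.
have XR : X%:~R = (p1 * D * k - N * a2)%:~R + N%:~R * D%:~R * b%:~R :> R.
  by rewrite -!intrM -intrD; congr (_%:~R); rewrite /X; ring.
have NR' : e%:~R = N%:~R * D%:~R * a%:~R - (n * X - (D * k - N * (a1 + a2 * n)))%:~R :> R.
  by rewrite -!intrM -intrB; congr (_%:~R); rewrite /e /N' /M; ring.
have e0 : 0 <= e < N * D.
  apply/andP; split; first by rewrite -(ler0z R) NR'; lra.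
  by rewrite -(ltr_int R) NR' intrM; lra.
have X1 : n%:~R * D%:~R / s <= X%:~R :> R by rewrite XR; lra.
have X2 : X%:~R < n%:~R * D%:~R / s + N%:~R * D%:~R :> R by rewrite XR; lra.
have X0 : 0 < X by rewrite -(ltr0z R) (lt_le_trans _ X1)// divr_gt0// mulr_gt0.
have N'e : N' = n * X + e by rewrite /e; ring.
have N'0 : 0 < N' by case/andP: e0 => e00 _; rewrite N'e ltr_wpDr// mulr_gt0.
have N'R : 0 < N'%:~R :> R by rewrite ltr0z.
have klR : k%:~R * p2%:~R = N%:~R * l%:~R + 1 :> R.
  by rewrite -!intrM -intrD1 -kl; congr (_%:~R); ring.
pose g := (n %/ D)%Z.
exists (RationalPt N' q1 q2 (- u * k - (w + u * (a - a2 * g)) * N)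
                        (- u * l - (w + u * (a - a2 * g)) * p2)), X, e.
(* These are the coordinates of m1 V + m2 U + m3 T. *)
have key : forall m1 m2 m3, transported (RationalPt N p1 p2 k l)
    (RationalPt N' q1 q2 (- u * k - (w + u * (a - a2 * g)) * N)
                        (- u * l - (w + u * (a - a2 * g)) * p2)) n X e
    (m1 * N + m2 * n * N + m3 * (k + a * N))
    (m1 * p1 + m2 * (n * p1 - 1) + m3 * (a * p1 - b))
    (m1 * p2 + m2 * n * p2 + m3 * (l + a * p2)) m1 m2 m3.
  move=> m1 m2 m3; rewrite /transported /lat1 /lat2 /xcoord /ycoord /=.
  have DN0 : D%:~R != 0 :> R by rewrite gt_eqF.
  have N'N0 : N'%:~R != 0 :> R by rewrite gt_eqF.
  split.
  - rewrite /N' /M !(intrD, intrM, intrB, mulrNz); field; exact: DN0.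
  - apply: (mulIf N'N0); rewrite mulrBl mulNr -(mulrA _ (_ / _)) !divfK//.
    rewrite /e /X /N' /q1 /M !(intrD, intrM, intrB, mulrNz, rmorph1).
    field; exact: DN0.
  - apply: (mulIf N'N0); rewrite mulrBl mulNr -(mulrA _ (_ / _)) !divfK//.
    rewrite /q2 /N' /M !(intrD, intrM, intrB, mulrNz, rmorph1).
    field: klR; exact: DN0.
split => //=.
- move=> Dn; split=> //=.
  have nE : n = g * D by rewrite /g divzK.
  (* D divides n, so M = - a1 modulo D, and the combination of the two Bezout
     relations is one for the new point. *)
  transitivity ((u * a1 + w * D) * (k * p2 - N * l)); last by rewrite uw kl.
  by rewrite /q2 /N' /M nE; ring.
- split; apply: frac_sub => //=; first by rewrite /q1 /X /N' /M; ring.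
  transitivity (p2 * N' - D * (k * p2 - N * l)); last by rewrite kl mulr1.
  by rewrite /q2 /N' /M; ring.
- by move=> m1 m2 m3; do 3 eexists; exact: key.
(* Conversely, m3, c2 and c1 are read off the coordinates in the basis V, u, u',
   which is unimodular. *)
- move=> q t1 t2; pose m3 := q * p2 - N * t2; pose c1 := k * t2 - l * q.
  pose c2 := c1 * p1 - t1; pose m2 := c2 - b * m3; pose m1 := c1 - n * m2 - a * m3.
  exists m1, m2, m3; have := key m1 m2 m3.
  have m3E : m3 = q * p2 - N * t2 by [].
  have c1E : m1 + n * m2 + a * m3 = c1 by rewrite /m1; ring.
  have c2E : m2 + b * m3 = c1 * p1 - t1 by rewrite /m2 /c2; ring.
  rewrite (_ : m1 * N + _ + _ = q); last first.
    transitivity (c1 * N + m3 * k); first by rewrite -c1E; ring.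
    transitivity (q * (k * p2 - N * l)); last by rewrite kl mulr1.
    by rewrite /c1 m3E; ring.
  rewrite (_ : m1 * p1 + _ + _ = t1); last first.
    transitivity (c1 * p1 - (m2 + b * m3)); first by rewrite -c1E; ring.
    by rewrite c2E; ring.
  rewrite (_ : m1 * p2 + _ + _ = t2)//.
  transitivity (c1 * p2 + m3 * l); first by rewrite -c1E; ring.
  transitivity (t2 * (k * p2 - N * l)); last by rewrite kl mulr1.
  by rewrite /c1 m3E; ring.
Qed.

End Transplant.

(** * The transplanted lattice is close to the model *)

(** In this section N is the denominator of the old point and P that of the new
one; X, e and n are the integers of [transplant]. All errors are O(1 / n). *)
Section Distortion.
Context {R : realType}.
Context {N D s n X e P : R}.
Hypotheses (N1 : 1 <= N) (D1 : 1 <= D) (s1 : 1 <= s) (n1 : 1 <= n).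
Hypotheses (X1 : n * D / s <= X) (X2 : X < n * D / s + N * D).
Hypotheses (e0 : 0 <= e) (e1 : e < N * D) (PE : P = n * X + e).

Let s0 : 0 < s. Proof. exact: lt_le_trans ltr01 s1. Qed.
Let n0 : 0 < n. Proof. exact: lt_le_trans ltr01 n1. Qed.
Let D0 : 0 < D. Proof. exact: lt_le_trans ltr01 D1. Qed.
Let N0 : 0 < N. Proof. exact: lt_le_trans ltr01 N1. Qed.

Lemma den_lower : n ^+ 2 * D <= s * P.
Proof.
have H : n * (n * D / s) <= n * X by rewrite ler_pM2l.
have -> : n ^+ 2 * D = s * (n * (n * D / s)) by field; rewrite gt_eqF.
by rewrite ler_pM2l// PE (le_trans H)// lerDl.
Qed.

Lemma den_upper : s * P <= n ^+ 2 * D + 2 * N * D * s * n.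
Proof.
have H : n * X <= n * (n * D / s + N * D) by rewrite ler_pM2l// ltW.
have {}H : s * (n * X) <= s * (n * (n * D / s + N * D)) by rewrite ler_pM2l.
have E : s * (n * (n * D / s + N * D)) = n ^+ 2 * D + N * D * s * n.
  by field; rewrite gt_eqF.
have H1 : s * e <= s * (N * D) by rewrite ler_pM2l// ltW.
have H2 : s * (N * D) <= s * (N * D) * n.
  by rewrite ler_peMr// !mulr_ge0 ?(le_trans ler01)// ltW.
by rewrite PE mulrDr; lra.
Qed.

Lemma den_gt0 : 0 < P.
Proof.
rewrite -(pmulr_rgt0 _ s0); apply: lt_le_trans den_lower.
by rewrite mulr_gt0// exprn_gt0.
Qed.

Let P0 : 0 < P. Proof. exact: den_gt0. Qed.

Lemma distort1 v1 v2 :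
  `|n * ((X * v1 - e * v2) / P) - v1| <= 2 * N * s ^+ 2 / n * (`|v1| + `|v2|).
Proof.
have -> : n * ((X * v1 - e * v2) / P) - v1 = - (e / P) * (v1 + n * v2).
  by rewrite PE; field; rewrite -PE gt_eqF.
have eP : 0 <= e / P by rewrite divr_ge0// ltW.
rewrite normrM normrN (ger0_norm eP).
have H : `|v1 + n * v2| <= n * (`|v1| + `|v2|).
  rewrite (le_trans (ler_normD _ _))// normrM (gtr0_norm n0) mulrDr lerD2r.
  by rewrite ler_peMl.
apply: (@le_trans _ _ (e / P * (n * (`|v1| + `|v2|)))).
  by rewrite ler_wpM2l.
rewrite mulrA ler_wpM2r// ?addr_ge0//.
rewrite -(ler_pM2r (mulr_gt0 n0 P0)).
have -> : e / P * n * (n * P) = n ^+ 2 * e by field; rewrite gt_eqF.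
have -> : 2 * N * s ^+ 2 / n * (n * P) = 2 * N * s ^+ 2 * P by field; rewrite gt_eqF.
have H1 : n ^+ 2 * e <= n ^+ 2 * (N * D) by rewrite ler_pM2l ?exprn_gt0// ltW.
have H2 : N * (n ^+ 2 * D) <= N * (s * P) by rewrite ler_pM2l ?(lt_le_trans ltr01)// den_lower.
have H3 : 0 <= N * (s * P) * (2 * s - 1).
  by rewrite !mulr_ge0 ?(ltW P0) ?(ltW s0) ?(ltW N0)//; move: s1; lra.
by lra.
Qed.

Lemma distort2 v1 v2 :
  `|n * (D * (v1 + n * v2) / P) - s * v2| <= 2 * N * s ^+ 2 / n * (`|v1| + `|v2|).
Proof.
have L := den_lower; have U := den_upper.
have -> : n * (D * (v1 + n * v2) / P) - s * v2 =
    n * D / P * v1 - (s * P - n ^+ 2 * D) / P * v2.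
  by field; rewrite gt_eqF.
rewrite mulrDr; apply: (le_trans (ler_normB _ _)).
have nDP : 0 <= n * D / P by rewrite divr_ge0 ?mulr_ge0 // ltW.
have dP : 0 <= (s * P - n ^+ 2 * D) / P by rewrite divr_ge0 ?subr_ge0 // ltW.
rewrite [`|_ * v1|]normrM [`|_ * v2|]normrM (ger0_norm nDP) (ger0_norm dP).
have E : 2 * N * s ^+ 2 / n * (n * P) = 2 * N * s ^+ 2 * P by field; rewrite gt_eqF.
have Ns : 1 <= N * s by rewrite mulr_ege1.
have sP : 0 <= s * P * (2 * (N * s) - 1).
  by rewrite !mulr_ge0 ?(ltW P0) ?(ltW s0)//; lra.
apply: lerD; apply: ler_wpM2r => //; rewrite -(ler_pM2r (mulr_gt0 n0 P0)) E.
  have -> : n * D / P * (n * P) = n ^+ 2 * D by field; rewrite gt_eqF.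
  by lra.
have -> : (s * P - n ^+ 2 * D) / P * (n * P) = n * (s * P - n ^+ 2 * D).
  by field; rewrite gt_eqF.
have H1 : n * (s * P - n ^+ 2 * D) <= n * (2 * N * D * s * n).
  by rewrite ler_pM2l//; lra.
have H2 : (2 * N * s) * (n ^+ 2 * D) <= (2 * N * s) * (s * P).
  by rewrite ler_pM2l// !mulr_gt0// (lt_le_trans ltr01).
by lra.
Qed.

End Distortion.

Lemma large_multiple {R : realType} (D : int) (K : seq R) : 0 < D ->
  exists n : int, [/\ (D %| n)%Z, 0 < n & {in K, forall x, x < n%:~R}].
Proof.
move=> D0; pose S := \sum_(x <- K) `|x|.
have S0 : 0 <= S by apply: sumr_ge0.
exists (D * (Num.floor S + 1)).
have F0 : 0 <= Num.floor S by rewrite floor_ge0.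
split; first by rewrite dvdz_mulr.
  by rewrite mulr_gt0//; lia.
move=> x xK; apply: (@le_lt_trans _ _ S).
  rewrite (le_trans (ler_norm x))// /S (big_rem x)//= lerDl.
  by apply: sumr_ge0.
apply: (@lt_le_trans _ _ (Num.floor S + 1)%:~R).
  by have /andP[] := floor_itv S.
by rewrite ler_int ler_peMl//; lia.
Qed.

Lemma small_slack {R : realType} (clo c c' chi : R) :
  0 < clo < c -> 0 <= c' < chi ->
  exists e : R, [/\ 0 < e, e <= 4^-1, clo <= c * (1 - e) ^+ 3 &
    c' * ((1 + e) * (1 + 2 * e) ^+ 2) <= chi].
Proof.
move=> /andP[lo0 lo] /andP[c'0 hi].
have c0 : 0 < c by lra.
pose e1 := (c - clo) / (3 * c); pose e2 := (chi - c') / (9 * (c' + 1)).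
have e10 : 0 < e1 by rewrite divr_gt0//; lra.
have e20 : 0 < e2 by rewrite divr_gt0//; lra.
have c31 : e1 * (3 * c) = c - clo by rewrite divfK// gt_eqF//; lra.
have c32 : e2 * (9 * (c' + 1)) = chi - c' by rewrite divfK// gt_eqF//; lra.
exists (Order.min 4^-1 (Order.min e1 e2)).
set e := Order.min _ _.
have ea : e <= 4^-1 by rewrite /e ge_min lexx.
have eb : e <= e1 by rewrite /e !ge_min lexx orbT.
have ec : e <= e2 by rewrite /e !ge_min lexx !orbT.
have e0 : 0 < e by rewrite /e !lt_min e10 e20 !andbT; lra.
split=> //.
  have : c * (1 - 3 * e) <= c * (1 - e) ^+ 3.
    by rewrite ler_pM2l//; nra.
  have : e * (3 * c) <= e1 * (3 * c) by rewrite ler_pM2r//; lra.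
  lra.
have H : (1 + e) * (1 + 2 * e) ^+ 2 <= 1 + 9 * e.
  have ee : e * e <= 4^-1 * e by rewrite ler_pM2r.
  have eee : e * (e * e) <= e * (4^-1 * e) by rewrite ler_pM2l.
  have -> : (1 + e) * (1 + 2 * e) ^+ 2 = 1 + 5 * e + 8 * (e * e) + 4 * (e * (e * e)).
    by ring.
  lra.
have : c' * ((1 + e) * (1 + 2 * e) ^+ 2) <= c' * (1 + 9 * e) by rewrite ler_wpM2l.
have : e * (9 * (c' + 1)) <= e2 * (9 * (c' + 1)) by rewrite ler_pM2r//; lra.
lra.
Qed.

Section NormDistortion.
Context {R : realType} {nu : 'rV[R]_2 -> R} (nu_norm : is_norm nu).

(** The error is relative to the norm of the model vector itself: the coordinates
of v are bounded by that norm, because s >= 1 and nu dominates k times the l1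
norm. So the estimate is uniform over the whole lattice. *)
Lemma norm_distort (k N D s n X e P eps v1 v2 : R) :
  0 < k -> (forall a b, k * (`|a| + `|b|) <= nu (pt a b)) ->
  1 <= N -> 1 <= D -> 1 <= s -> 1 <= n ->
  n * D / s <= X -> X < n * D / s + N * D -> 0 <= e -> e < N * D ->
  P = n * X + e ->
  2 * N * s ^+ 2 * (nu (pt 1 0) + nu (pt 0 1)) <= eps * k * n ->
  `|n * nu (pt ((X * v1 - e * v2) / P) (D * (v1 + n * v2) / P)) -
     nu (pt v1 (s * v2))| <= eps * nu (pt v1 (s * v2)).
Proof.
move=> k0 kP N1 D1 s1 n1 X1 X2 e0 e1 PE epsP.
have n0 : 0 < n by lra.
set w1 := _ / P; set w2 := _ / P.
have -> : n * nu (pt w1 w2) = nu (pt (n * w1) (n * w2)).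
  by rewrite norm_scale2// gtr0_norm.
set L := `|v1| + `|v2|.
have L0 : 0 <= L by rewrite addr_ge0.
set F := nu (pt 1 0) + nu (pt 0 1) in epsP *.
have F0 : 0 <= F by rewrite addr_ge0// norm_ge0.
have H : nu (pt (n * w1 - v1) (n * w2 - s * v2)) <= eps * nu (pt v1 (s * v2)).
  have d1 := distort1 N1 D1 s1 n1 X1 e0 e1 PE v1 v2.
  have d2 := distort2 N1 D1 s1 n1 X1 X2 e0 e1 PE v1 v2.
  apply: (le_trans (norm_le_coord nu_norm _ _)).
  apply: (@le_trans _ _ (2 * N * s ^+ 2 / n * L * F)).
    by rewrite mulrDr lerD// ler_wpM2r// norm_ge0.
  have E : 2 * N * s ^+ 2 / n * L * F = (2 * N * s ^+ 2 * F) * (L / n).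
    by field; rewrite gt_eqF.
  rewrite E; apply: (@le_trans _ _ (eps * k * n * (L / n))).
    by rewrite ler_wpM2r// divr_ge0// ltW.
  have -> : eps * k * n * (L / n) = eps * (k * L) by field; rewrite gt_eqF.
  have eps0 : 0 <= eps.
    have : 0 <= eps * (k * n).
      by rewrite mulrA (le_trans _ epsP)// !mulr_ge0 ?exprn_ge0//; lra.
    by rewrite pmulr_lge0// mulr_gt0.
  rewrite ler_wpM2l// (le_trans _ (kP _ _))// ler_pM2l// lerD2l normrM.
  by rewrite ler_peMl// ger0_norm; lra.
rewrite ler_norml; apply/andP; split.
  have := norm_le_sub nu_norm v1 (s * v2) (n * w1) (n * w2).
  rewrite -(norm_oppr2 nu_norm (v1 - _)) !opprB; lra.
have := norm_le_sub nu_norm (n * w1) (n * w2) v1 (s * v2); lra.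
Qed.

End NormDistortion.

Lemma le_of_sqr {R : realType} (a C : R) : 0 <= C -> a ^+ 2 <= C -> a <= C + 1.
Proof. by move=> C0; rewrite leNgt => aC; rewrite leNgt; apply: contra aC; nra. Qed.

(** A model vector of norm S and height less than j becomes a vector of norm at
most (1 + eps) S / n and height at most Z j + W, where Z is n^2 / s up to a factor
1 + eps; the product of the height and the squared norm is thus j S^2 / s up to
small factors. The next lemma is the reverse comparison. *)
Lemma window_upper_estimate {R : realType} (n s Z eps W t j E S c' chi : R) :
  0 < n -> 0 < s -> 0 < eps ->
  s * Z <= n ^+ 2 * (1 + eps) -> s * W <= eps * n ^+ 2 ->
  1 <= j -> 0 <= t <= Z * j + W -> 0 <= E -> 0 <= S -> n * E <= (1 + eps) * S ->
  j * S ^+ 2 <= c' * s -> 0 <= c' ->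
  c' * ((1 + eps) * (1 + 2 * eps) ^+ 2) <= chi ->
  t * E ^+ 2 <= chi.
Proof.
move=> n0 s0 eps0 sZ sW j1 /andP[t0 tZ] E0 S0 nE jS c'0; apply: le_trans.
have n20 : 0 < n ^+ 2 by rewrite exprn_gt0.
have st : s * t <= n ^+ 2 * (1 + 2 * eps) * j.
  have H1 : s * t <= s * (Z * j + W) by rewrite ler_pM2l.
  have H2 : s * Z * j <= n ^+ 2 * (1 + eps) * j by rewrite ler_pM2r//; lra.
  have H3 : eps * n ^+ 2 * 1 <= eps * n ^+ 2 * j by rewrite ler_pM2l// mulr_gt0.
  lra.
have nE2 : n ^+ 2 * E ^+ 2 <= (1 + eps) ^+ 2 * S ^+ 2.
  by rewrite -!exprMn ler_sqr// nnegrE mulr_ge0//; lra.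
have st0 : 0 <= s * t by rewrite mulr_ge0// ltW.
have H1 : s * t * (n ^+ 2 * E ^+ 2) <= s * t * ((1 + eps) ^+ 2 * S ^+ 2).
  by rewrite ler_wpM2l.
have H2 : s * t * ((1 + eps) ^+ 2 * S ^+ 2) <=
    n ^+ 2 * (1 + 2 * eps) * j * ((1 + eps) ^+ 2 * S ^+ 2).
  by rewrite ler_wpM2r// mulr_ge0 ?sqr_ge0.
have H3 : n ^+ 2 * (1 + 2 * eps) * (1 + eps) ^+ 2 * (j * S ^+ 2) <=
    n ^+ 2 * (1 + 2 * eps) * (1 + eps) ^+ 2 * (c' * s).
  by rewrite ler_wpM2l// !mulr_ge0 ?sqr_ge0//; lra.
have H4 : s * n ^+ 2 * (t * E ^+ 2) <=
    s * n ^+ 2 * (c' * ((1 + 2 * eps) * (1 + eps) ^+ 2)) by lra.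
rewrite ler_pM2l ?mulr_gt0// in H4.
apply: (le_trans H4); rewrite ler_wpM2l//.
have -> : (1 + eps) * (1 + 2 * eps) ^+ 2 = (1 + 2 * eps) * ((1 + eps) * (1 + 2 * eps)).
  by ring.
rewrite ler_pM2l; last lra.
by rewrite expr2 ler_pM2l; lra.
Qed.

Lemma window_lower_estimate {R : realType} (n s Z eps j E S c clo : R) :
  0 < n -> 0 < s -> 0 < eps < 1 ->
  n ^+ 2 <= s * Z -> 1 <= j -> 0 <= E -> 0 <= S -> (1 - eps) * S <= n * E ->
  clo <= c * (1 - eps) ^+ 3 ->
  Z * j * (1 - eps) * E ^+ 2 < clo -> j * S ^+ 2 < c * s.
Proof.
move=> n0 s0 /andP[eps0 eps1] sZ j1 E0 S0 nE cloc H.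
have n20 : 0 < n ^+ 2 by rewrite exprn_gt0.
have d0 : 0 < 1 - eps by lra.
have nE2 : (1 - eps) ^+ 2 * S ^+ 2 <= n ^+ 2 * E ^+ 2.
  by rewrite -!exprMn ler_sqr// nnegrE mulr_ge0//; lra.
have Q0 : 0 <= j * (1 - eps) * E ^+ 2.
  by rewrite !mulr_ge0 ?sqr_ge0 ?(ltW d0)//; lra.
have H1 : n ^+ 2 * (j * (1 - eps) * E ^+ 2) <= s * Z * (j * (1 - eps) * E ^+ 2).
  by rewrite ler_wpM2r.
have H2 : s * (Z * j * (1 - eps) * E ^+ 2) < s * (c * (1 - eps) ^+ 3).
  by rewrite ltr_pM2l// (lt_le_trans H).
have H3 : j * (1 - eps) * ((1 - eps) ^+ 2 * S ^+ 2) <= j * (1 - eps) * (n ^+ 2 * E ^+ 2).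
  by rewrite ler_pM2l// mulr_gt0//; lra.
have H4 : (1 - eps) ^+ 3 * (j * S ^+ 2) < (1 - eps) ^+ 3 * (c * s) by lra.
by rewrite ltr_pM2l ?exprn_gt0// in H4.
Qed.

Section Approximation.
Context {R : realType} {nu : 'rV[R]_2 -> R} (nu_norm : is_norm nu).

Definition model_norm (D a1 a2 : int) (s : R) (m1 m2 m3 : int) : R :=
  nu (pt (lat1 D a1 m1 m3) (s * lat2 D a2 m2 m3)).

(** The value of the model is the maximum over j of (j + 1) S_j^2 / s, where S_j is
the least norm of a nonzero vector of height at most j. The factor j + 1 appears
because heights are integers: the vectors of height less than h are the same for
all h in (j, j + 1]. The factor 1 / s compensates for the determinant of the
stretching. Deep means that this value is at least c, and shallow that it is at
most c, expressed without the minima S_j. *)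
Definition deep (D a1 a2 : int) (s c : R) := exists j : nat,
  forall m1 m2 m3 : int, (m1, m2, m3) != (0, 0, 0) -> `|m3| <= j%:Z ->
    c * s <= j.+1%:R * model_norm D a1 a2 s m1 m2 m3 ^+ 2.

Definition shallow (D a1 a2 : int) (s c : R) := forall j : nat,
  exists m1 m2 m3 : int, [/\ (m1, m2, m3) != (0, 0, 0), `|m3| <= j%:Z &
    j.+1%:R * model_norm D a1 a2 s m1 m2 m3 ^+ 2 <= c * s].

(** The consequences of [transported] that matter: Z is the scale of heights, W
the height error for vectors of norm at most C, and 1 / n the scale of norms. The
last clause covers the vertical vectors, which have no height error. *)
Definition comparable_vec (D a1 a2 : int) (s n Z W C eps : R) (r' : rational_pt)
    (q p1 p2 m1 m2 m3 : int) :=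
  let S := model_norm D a1 a2 s m1 m2 m3 in
  let E := err nu (xcoord r') (ycoord r') q p1 p2 in
  [/\ S <= C -> `|q%:~R - Z * m3%:~R| <= W, (1 - eps) * S <= n * E,
      n * E <= (1 + eps) * S & S = 0 -> q%:~R = Z * m3%:~R].

(** Here X / (N P) and D / (N P) are, up to sign, the coordinates of the displacement
from the old point to the new one. *)
Lemma coord_close (d N P n s X D : R) :
  0 < d -> 1 <= N -> 0 < s -> 1 <= n -> 1 <= D -> 0 <= X -> n * X <= P ->
  n ^+ 2 * D <= s * P -> 2 * N <= d * n -> 2 * N * s <= d * n ->
  X / (N * P) <= d / (2 * N ^+ 2) /\ D / (N * P) <= d / (2 * N ^+ 2).
Proof.
move=> d0 N1 s0 n1 D1 X0 XP PL dn dn'.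
have n0 : 0 < n by lra.
have N0 : 0 < N by lra.
have P0 : 0 < P.
  by rewrite -(pmulr_rgt0 _ s0) (lt_le_trans _ PL)// mulr_gt0 ?exprn_gt0//; lra.
have dist h : 0 <= h -> 2 * N * h <= d * P -> h / (N * P) <= d / (2 * N ^+ 2).
  move=> h0 hP; rewrite ler_pdivrMr ?mulr_gt0//.
  have -> : d / (2 * N ^+ 2) * (N * P) = d * P / (2 * N) by field; rewrite gt_eqF.
  by rewrite ler_pdivlMr ?mulr_gt0//; lra.
split; apply: dist => //.
- have H1 : 2 * N * X <= d * n * X by rewrite ler_wpM2r.
  have H2 : d * (n * X) <= d * P by rewrite ler_pM2l.
  lra.
- lra.
- have H2 : d * (n ^+ 2 * D) <= d * (s * P) by rewrite ler_pM2l.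
  have H1 : 2 * N * s * (n * D) <= d * n * (n * D).
    by rewrite ler_wpM2r// mulr_ge0//; lra.
  have H3 : 2 * N * s * (1 * D) <= 2 * N * s * (n * D).
    by rewrite ler_wpM2l ?mulr_ge0 ?ler_wpM2r//; lra.
  have H4 : s * (2 * N * D) <= s * (d * P) by lra.
  by rewrite ler_pM2l in H4.
Qed.

(** K expresses how large n has to be and how small the height error W has to be
in comparison with the heights, which are of order n^2. *)
Lemma approximating_lattice (D a1 a2 u w : int) (s eps C K : R) :
  0 < D -> u * a1 + w * D = 1 -> 1 <= s -> 0 < eps -> 0 < C -> 0 <= K ->
  forall (r : rational_pt) (d : R), reduced r -> 0 < d ->
  exists (r' : rational_pt) (n Z W : R),
  [/\ [/\ reduced r', `|xcoord r' - xcoord r| <= d / (2 * (den r)%:~R ^+ 2) &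
          `|ycoord r' - ycoord r| <= d / (2 * (den r)%:~R ^+ 2)],
      [/\ 1 <= n, K <= n, 0 < W & K * W <= n ^+ 2],
      [/\ n ^+ 2 <= s * Z, s * Z <= n ^+ 2 * (1 + eps),
          2 * (den r)%:~R <= Z & Z * D%:~R = (den r')%:~R],
      exists p1 p2, n * err nu (xcoord r') (ycoord r') (den r) p1 p2 <=
        (1 + eps) * nu (pt 1 0) &
      (forall m1 m2 m3, exists q p1 p2,
         comparable_vec D a1 a2 s n Z W C eps r' q p1 p2 m1 m2 m3) /\
      (forall q p1 p2, exists m1 m2 m3,
         comparable_vec D a1 a2 s n Z W C eps r' q p1 p2 m1 m2 m3)].
Proof.
move=> D0 uw s1 eps0 C0 K0 r d rr d0.
have [k k0 kP] := norm_ge_coord nu_norm.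
have N0 : 0 < den r by case: rr.
set N := (den r)%:~R : R; set DR := D%:~R : R.
have N1 : 1 <= N by rewrite /N ler1z -gtz0_ge1.
have D1 : 1 <= DR by rewrite /DR ler1z -gtz0_ge1.
have NR0 : 0 < N by exact: lt_le_trans ltr01 N1.
have DR0 : 0 < DR by exact: lt_le_trans ltr01 D1.
pose F := nu (pt 1 0) + nu (pt 0 1).
pose Cv := C / k.
have Cv0 : 0 < Cv by rewrite divr_gt0.
have s0 : 0 < s by exact: lt_le_trans ltr01 s1.
(* In this order: relative error of norms, relative error of the height scale,
   distance between the two points (twice), growth of the denominator, and the
   two requirements expressed by K. *)
have [n [Dn n0 nK]] := large_multiple D [:: 2 * N * s ^+ 2 * F / (eps * k);
  2 * N * s / eps; 2 * N * s / d; 2 * N / d; 2 * N * s; K; K * (N * Cv)] D0.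
set nR := n%:~R : R.
have n1 : 1 <= nR by rewrite /nR ler1z -gtz0_ge1.
have nR0 : 0 < nR by exact: lt_le_trans ltr01 n1.
have K1 : 2 * N * s ^+ 2 * F <= eps * k * nR.
  by rewrite [_ * nR]mulrC -ler_pdivrMr ?mulr_gt0// ltW// nK// !inE eqxx.
have K2 : 2 * N * s <= eps * nR.
  by rewrite [_ * nR]mulrC -ler_pdivrMr// ltW// nK// !inE eqxx !orbT.
have K3 : 2 * N * s <= d * nR.
  by rewrite [_ * nR]mulrC -ler_pdivrMr// ltW// nK// !inE eqxx !orbT.
have K4 : 2 * N <= d * nR.
  by rewrite [_ * nR]mulrC -ler_pdivrMr// ltW// nK// !inE eqxx !orbT.
have K5 : 2 * N * s <= nR by rewrite ltW// nK// !inE eqxx !orbT.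
have K6 : K <= nR by rewrite ltW// nK// !inE eqxx !orbT.
have K7 : K * (N * Cv) <= nR by rewrite ltW// nK// !inE eqxx !orbT.
clear nK.
have [r' [X [e [[X1 X2 e01 r'E] red [xE yE] lat lat']]]] :=
  transplant D a1 a2 r u w n s rr D0 uw s1 n0.
rewrite -/N -/DR -/nR in X1 X2 xE yE.
set XR := X%:~R : R in X1 X2 xE; pose eR := e%:~R : R.
have /andP[e0 e1] : (0 <= eR) && (eR < N * DR).
  by move: e01; rewrite -intrM ler0z ltr_int.
set P := (den r')%:~R : R in xE yE.
have PE : P = nR * XR + eR by rewrite /P r'E intrD intrM.
have P0 := den_gt0 D1 s1 n1 X1 e0 PE.
have PL := den_lower s1 n1 X1 e0 PE.
have PU : s * P <= nR ^+ 2 * DR * (1 + eps).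
  apply: (le_trans (den_upper N1 D1 s1 n1 X2 e1 PE)).
  rewrite mulrDr mulr1 lerD2l.
  have : DR * nR * (2 * N * s) <= DR * nR * (eps * nR) by rewrite ler_pM2l// mulr_gt0.
  by congr (_ <= _); ring.
pose Z := P / DR.
have ZP : Z * DR = P by rewrite /Z divfK// gt_eqF.
have ZL : nR ^+ 2 <= s * Z by rewrite /Z mulrA ler_pdivlMr.
have cmp q p1 p2 m1 m2 m3 : @transported R D a1 a2 r r' n X e q p1 p2 m1 m2 m3 ->
    comparable_vec D a1 a2 s nR Z (N * nR * Cv) C eps r' q p1 p2 m1 m2 m3.
  rewrite /transported /= => -[qE xq yq].
  have := norm_distort nu_norm k N DR s nR XR eR P eps (lat1 D a1 m1 m3)
     (lat2 D a2 m2 m3) k0 kP N1 D1 s1 n1 X1 X2 e0 e1 PE K1.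
  rewrite -/(model_norm D a1 a2 s m1 m2 m3) ler_norml => /andP[H1 H2].
  rewrite /comparable_vec /err xq yq norm_oppr2//.
  move: H1 H2; set S := model_norm _ _ _ _ _ _ _; set E := nu _ => H1 H2.
  have vS : `|lat1 D a1 m1 m3 + nR * lat2 D a2 m2 m3| <= nR * (S / k).
    rewrite (le_trans (ler_normD _ _))//.
    apply: (@le_trans _ _ (nR * (`|lat1 D a1 m1 m3 : R| + `|s * lat2 D a2 m2 m3|))).
      rewrite [leRHS]mulrDr; apply: lerD; first by rewrite ler_peMl.
      by rewrite !normrM (gtr0_norm nR0) (gtr0_norm s0) ler_pM2l// ler_peMl.
    by rewrite ler_pM2l// ler_pdivlMr// mulrC kP.
  have qZ : q%:~R - Z * m3%:~R = N * (lat1 D a1 m1 m3 + nR * lat2 D a2 m2 m3).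
    by rewrite qE addrAC subrr add0r.
  split.
  - move=> SC; rewrite qZ normrM (gtr0_norm NR0) -mulrA ler_pM2l//.
    by rewrite (le_trans vS)// ler_pM2l// ler_pM2r ?invr_gt0.
  - by rewrite mulrBl mul1r lerBlDr; move: H1; rewrite lerBrDr addrC lerBlDr.
  - by rewrite mulrDl mul1r addrC -lerBlDr.
  - move=> S0; apply/eqP; rewrite -subr_eq0 qZ mulf_eq0; apply/orP; right.
    by rewrite -normr_le0 (le_trans vS)// S0 mul0r mulr0.
exists r', nR, Z, (N * nR * Cv); split.
- have XP : nR * XR <= P by rewrite PE lerDl.
  have X0 : 0 <= XR by rewrite (le_trans _ X1)// divr_ge0 ?mulr_ge0// ltW.
  have [dx dy] := coord_close d N P nR s XR DR d0 N1 s0 n1 D1 X0 XP PL K4 K3.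
  split; first exact: red.
    rewrite xE addrAC subrr add0r normrN ger0_norm// divr_ge0// mulr_ge0// ltW//.
  by rewrite yE addrAC subrr add0r normrN ger0_norm// divr_ge0 ?mulr_ge0// ltW//.
- split => //; first by apply: mulr_gt0 => //; apply: mulr_gt0.
  have : K * (N * Cv) * nR <= nR * nR by rewrite ler_pM2r.
  by congr (_ <= _); ring.
- split => //.
    by rewrite /Z mulrA ler_pdivrMr// mulrAC.
  rewrite -(ler_pM2l s0) (le_trans _ ZL)// mulrC expr2.
  by rewrite (le_trans K5)// ler_peMr// ltW.
- have [q [p1 [p2 T]]] := lat 1 0 0.
  have [_ _ Eu _] := cmp _ _ _ _ _ _ T.
  have qN : q = den r.
    apply/eqP; rewrite -(eqr_int R); case: T => -> _ _.
    by rewrite /lat1 /lat2 !(mulr0z, mulr1z, mul0r, mulr0, addr0, add0r, mulr1).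
  exists p1, p2; rewrite -qN (le_trans Eu)//.
  by rewrite /model_norm /lat1 /lat2 !(mulr0z, mulr1z, mul0r, mulr0, addr0).
- split.
    by move=> m1 m2 m3; have [q [p1 [p2 T]]] := lat m1 m2 m3; exists q, p1, p2; exact: cmp.
  by move=> q p1 p2; have [m1 [m2 [m3 T]]] := lat' q p1 p2; exists m1, m2, m3; exact: cmp.
Qed.

End Approximation.

(** * Windows: the best multiples between two denominators *)

Section Window.
Context {R : realType} {nu : 'rV[R]_2 -> R} (nu_norm : is_norm nu).

Lemma model_norm_ge0 D a1 a2 (s : R) m1 m2 m3 : 0 <= model_norm (nu := nu) D a1 a2 s m1 m2 m3.
Proof. exact: norm_ge0. Qed.

Lemma model_norm_eq0 D a1 a2 (s : R) m1 m2 : 0 < s ->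
  model_norm (nu := nu) D a1 a2 s m1 m2 0 = 0 -> (m1, m2) = (0, 0).
Proof.
move=> s0 /(norm_eq0 nu_norm)/rowP e.
have := e 0; have := e 1; rewrite !mxE /lat1 /lat2 /= !mul0r !addr0.
move=> /eqP; rewrite mulf_eq0 gt_eqF//= intr_eq0 => /eqP -> /eqP.
by rewrite intr_eq0 => /eqP ->.
Qed.

Lemma err_oppr (x y : R) q p1 p2 : err nu x y (- q) (- p1) (- p2) = err nu x y q p1 p2.
Proof.
by rewrite /err -[RHS](norm_oppr2 nu_norm) !mulrNz; congr (nu (pt _ _)); ring.
Qed.

Lemma err0_small (k x y : R) p1 p2 :
  (forall a b, k * (`|a| + `|b|) <= nu (pt a b)) -> 0 < k ->
  err nu x y 0 p1 p2 < k -> err nu x y 0 p1 p2 = 0.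
Proof.
move=> kP k0; rewrite /err !mul0r !sub0r norm_oppr2// => H.
have {H} := le_lt_trans (kP _ _) H.
rewrite gtr_pMr// -!intr_norm -intrD -[1]/(1%:~R) ltr_int => H.
have [-> ->] : p1 = 0 /\ p2 = 0 by lia.
exact: norm_0.
Qed.

Section Halves.
Context {D a1 a2 : int} {s n Z W C eps k : R} {r' : rational_pt}.
Hypotheses (k0 : 0 < k) (kP : forall a b, k * (`|a| + `|b|) <= nu (pt a b)).
Hypotheses (s0 : 0 < s) (n0 : 0 < n) (W0 : 0 < W) (eps0 : 0 < eps) (eps4 : eps <= 4^-1).
Hypotheses (ZL : n ^+ 2 <= s * Z) (sW : 2 * (s * W) <= eps * n ^+ 2).

Let Z0 : 0 < Z.
Proof. by rewrite -(pmulr_rgt0 _ s0) (lt_le_trans _ ZL)// exprn_gt0. Qed.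

Let S := model_norm (nu := nu) D a1 a2 s.
Let E := err nu (xcoord r') (ycoord r').
Let comparable := comparable_vec (nu := nu) D a1 a2 s n Z W C eps r'.

(** A short vector of height 0 would be a short integer point, hence 0. *)
Lemma comparable_neq0 q p1 p2 m1 m2 m3 : 2 * C < k * n ->
  comparable q p1 p2 m1 m2 m3 -> S m1 m2 m3 <= C ->
  (m1, m2, m3) != (0, 0, 0) -> q != 0.
Proof.
move=> Ck [_ lo hi eqZ] SC; apply: contraNneq => q0; rewrite q0 in lo hi eqZ.
have ek : err nu (xcoord r') (ycoord r') 0 p1 p2 < k.
  rewrite -(ltr_pM2r n0) mulrC (le_lt_trans hi)// (le_lt_trans _ Ck)//.
  by apply: ler_pM => //; [move: eps0; lra|exact: norm_ge0|move: eps4; lra].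
have e0 := err0_small _ _ _ _ _ kP k0 ek; rewrite e0 mulr0 in lo.
have S0 : S m1 m2 m3 = 0.
  apply/eqP; rewrite eq_le model_norm_ge0 andbT -(@pmulr_rle0 _ (1 - eps))//.
  by move: eps4; lra.
have := eqZ S0 => /esym/eqP; rewrite mulf_eq0 gt_eqF//= intr_eq0 => /eqP m30.
by move: S0; rewrite m30 => /(model_norm_eq0 _ _ _ _ _ _ s0)[-> ->].
Qed.

(** The height t corresponds to the index j = floor ((t - W) / Z) of the model, and
the vector that witnesses shallowness at j has height at most Z j + W <= t. *)
Lemma window_upper (c' chi t : R) :
  s * Z <= n ^+ 2 * (1 + eps) -> 2 * C < k * n ->
  0 <= c' -> c' * s + 1 <= C ->
  c' * ((1 + eps) * (1 + 2 * eps) ^+ 2) <= chi ->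
  shallow (nu := nu) D a1 a2 s c' ->
  (forall m1 m2 m3, exists q p1 p2, comparable q p1 p2 m1 m2 m3) ->
  W <= t -> exists q p1 p2 : int, [/\ 0 < q, q%:~R <= t & t * E q p1 p2 ^+ 2 <= chi].
Proof.
move=> ZU Ck c'0 c'C highE Hshallow lat Wt.
pose j := Num.truncn ((t - W) / Z).
have /andP[j1 j2] : j%:R <= (t - W) / Z < j.+1%:R.
  by apply: truncn_itv; rewrite divr_ge0 ?(ltW Z0)// subr_ge0.
rewrite ler_pdivlMr// in j1; rewrite ltr_pdivrMr// in j2.
have [m1 [m2 [m3 [m0 m3j Sj]]]] := Hshallow j.
have jS1 : (1 : R) <= j.+1%:R by rewrite ler1n.
have c's0 : 0 <= c' * s by rewrite mulr_ge0// ltW.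
have SC : S m1 m2 m3 <= C.
  rewrite (le_trans _ c'C)// le_of_sqr//.
  by rewrite (le_trans _ Sj)// ler_peMl// sqr_ge0.
have [q [p1 [p2 cmp]]] := lat m1 m2 m3.
have q0 := comparable_neq0 _ _ _ _ _ _ Ck cmp SC m0.
have [/(_ SC) qZ _ Eu _] := cmp.
have qt : `|q%:~R : R| <= t.
  have : `|Z * m3%:~R| <= j%:R * Z.
    rewrite normrM (gtr0_norm Z0) mulrC ler_pM2r// -intr_norm.
    by rewrite -[j%:R]/((j%:Z)%:~R) ler_int.
  have := ler_normD (q%:~R - Z * m3%:~R) (Z * m3%:~R); rewrite subrK.
  by move: j1 qZ; lra.
have t0 : 0 <= t <= Z * j.+1%:R + W.
  by apply/andP; split; [rewrite (le_trans _ Wt)// ltW|move: j2; lra].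
have Efin : t * E q p1 p2 ^+ 2 <= chi.
  apply: (@window_upper_estimate R n s Z eps W t j.+1%:R _ (S m1 m2 m3) c' chi) => //.
  - by rewrite (le_trans _ sW)// ler_peMl// ?ler1n// mulr_ge0// ltW.
  - exact: norm_ge0.
  - exact: norm_ge0.
have [q_gt0|q_le0] := ltP 0 q.
  by exists q, p1, p2; split => //; rewrite (le_trans (ler_norm _)).
exists (- q), (- p1), (- p2); split.
- by rewrite oppr_gt0 lt_neqAle q0.
- by rewrite mulrNz (le_trans (ler_norm _))// normrN.
- by rewrite /E err_oppr.
Qed.

(** At a height slightly below Z (j + 1), a multiple that came too close to Z^2
would correspond to a model vector of height less than j + 1, contradicting
deepness at j. *)
Lemma window_lower (c clo : R) (j : nat) (t : R) :
  0 < c -> c * s + 1 <= C -> clo <= c * (1 - eps) ^+ 3 ->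
  (forall m1 m2 m3 : int, (m1, m2, m3) != (0, 0, 0) -> `|m3| <= j%:Z ->
    c * s <= j.+1%:R * S m1 m2 m3 ^+ 2) ->
  (forall q p1 p2, exists m1 m2 m3, comparable q p1 p2 m1 m2 m3) ->
  t = Z * j.+1%:R * (1 - eps) ->
  forall q p1 p2 : int, 0 < q -> q%:~R <= t -> clo <= t * E q p1 p2 ^+ 2.
Proof.
move=> c0 cC lowE Hdeep lat tE q p1 p2 q0 qt.
have [m1 [m2 [m3 [qZ Elo _ eqZ]]]] := lat q p1 p2.
rewrite leNgt; apply/negP => Eclo.
have jS1 : (1 : R) <= j.+1%:R by rewrite ler1n.
have jS : j.+1%:R * S m1 m2 m3 ^+ 2 < c * s.
  apply: (@window_lower_estimate R n s Z eps _ (E q p1 p2) (S m1 m2 m3) c clo) => //.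
  - by apply/andP; split => //; move: eps4; lra.
  - exact: norm_ge0.
  - exact: norm_ge0.
  - by rewrite -tE.
have cs0 : 0 < c * s by rewrite mulr_gt0.
have SC : S m1 m2 m3 <= C.
  rewrite (le_trans _ cC)// le_of_sqr ?ltW// (le_lt_trans _ jS)//.
  by rewrite ler_peMl// sqr_ge0.
have m0 : (m1, m2, m3) != (0, 0, 0).
  apply: contraTneq q0 => -[m10 m20 m30].
  rewrite m10 m20 m30 in eqZ; rewrite -(ltr0z R) eqZ ?mulr0 ?ltxx//.
  by rewrite /model_norm /lat1 /lat2 !mul0r addr0 mulr0 norm_0.
have m3j : `|m3| <= j%:Z.
  rewrite -ltzD1 -(ltr_int R) intr_norm intrD -[(j%:Z)%:~R]/(j%:R : R) natr1.
  have Zm : Z * `|m3%:~R| = `|Z * m3%:~R| by rewrite normrM (gtr0_norm Z0).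
  rewrite -(ltr_pM2l Z0) Zm.
  have WZ : 2 * W <= Z * eps.
    have : s * (2 * W) <= s * (Z * eps).
      have : eps * n ^+ 2 <= eps * (s * Z) by rewrite ler_pM2l.
      by move: sW; lra.
    by rewrite ler_pM2l.
  have Zj : Z * eps * 1 <= Z * eps * j.+1%:R by rewrite ler_pM2l// mulr_gt0.
  have Ze : 0 < Z * eps by rewrite mulr_gt0.
  have := ler_normB (q%:~R) (q%:~R - Z * m3%:~R).
  have -> : q%:~R - (q%:~R - Z * m3%:~R) = Z * m3%:~R by ring.
  have -> : `|q%:~R : R| = q%:~R by rewrite gtr0_norm// ltr0z.
  by have := qZ SC; move: qt WZ Zj Ze; rewrite tE; lra.
have := Hdeep _ _ _ m0 m3j; rewrite leNgt => /negP; exact.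
Qed.

End Halves.
End Window.

Section WindowStep.
Context {R : realType} {nu : 'rV[R]_2 -> R} (nu_norm : is_norm nu).

(** The maximum of t * dist^2 over t in [den r, den r'], for the point r', lies
between clo and chi. *)
Definition window (r r' : rational_pt) (clo chi : R) :=
  (forall t : R, (den r)%:~R <= t -> t <= (den r')%:~R ->
     exists q p1 p2 : int, [/\ 0 < q, q%:~R <= t &
       t * err nu (xcoord r') (ycoord r') q p1 p2 ^+ 2 <= chi]) /\
  (exists t : R, [/\ (den r)%:~R <= t, t <= (den r')%:~R &
     forall q p1 p2 : int, 0 < q -> q%:~R <= t ->
       clo <= t * err nu (xcoord r') (ycoord r') q p1 p2 ^+ 2]).

(** The model contains the vertical vector of height D, whose norm is 0. *)
Lemma deep_index_bound (D a1 a2 : int) (s c : R) (j : nat) : 0 < D -> 0 < c * s ->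
  (forall m1 m2 m3 : int, (m1, m2, m3) != (0, 0, 0) -> `|m3| <= j%:Z ->
    c * s <= j.+1%:R * model_norm (nu := nu) D a1 a2 s m1 m2 m3 ^+ 2) ->
  j.+1%:R <= D%:~R :> R.
Proof.
move=> D0 cs0 Hdeep.
have [Dj|jD] := leP D j%:Z; last by rewrite -[j.+1%:R]/((j.+1%:Z)%:~R) ler_int.
have := Hdeep (- a1) (- a2) D; rewrite gtr0_norm// => /(_ _ Dj).
have D_neq0 : D%:~R != 0 :> R by rewrite intr_eq0 gt_eqF.
have v10 : lat1 D a1 (- a1) D = 0 :> R by rewrite /lat1 mulrNz; field.
have v20 : lat2 D a2 (- a2) D = 0 :> R by rewrite /lat2 mulrNz; field.
have -> : model_norm (nu := nu) D a1 a2 s (- a1) (- a2) D = 0.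
  by rewrite /model_norm v10 v20 mulr0 norm_0.
rewrite expr0n mulr0 leNgt cs0 => H; exfalso; suff: false by []; apply: H.
by apply/eqP => -[_ _ D00]; rewrite D00 in D0.
Qed.

Lemma window_step (D a1 a2 u w : int) (s c c' clo chi : R) :
  0 < D -> u * a1 + w * D = 1 -> 1 <= s ->
  0 < clo < c -> 0 <= c' < chi ->
  deep (nu := nu) D a1 a2 s c -> shallow (nu := nu) D a1 a2 s c' ->
  forall (r : rational_pt) (d : R), reduced r -> 0 < d ->
  exists r' : rational_pt, [/\ reduced r', 2 * den r <= den r',
    `|xcoord r' - xcoord r| <= d / (2 * (den r)%:~R ^+ 2) /\
    `|ycoord r' - ycoord r| <= d / (2 * (den r)%:~R ^+ 2) &
    window r r' clo chi].
Proof.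
move=> D0 uw s1 clo_c c'_chi [j Hdeep] Hshallow r d rr d0.
have [k k0 kP] := norm_ge_coord nu_norm.
have [eps [eps0 eps4 lowE highE]] := small_slack clo c c' chi clo_c c'_chi.
have s0 : 0 < s by exact: lt_le_trans ltr01 s1.
have c0 : 0 < c by case/andP: clo_c => /lt_trans; apply.
have c'0 : 0 <= c' by case/andP: c'_chi.
have chi0 : 0 < chi by case/andP: c'_chi => /le_lt_trans; apply.
have cs0 : 0 < c * s by rewrite mulr_gt0.
have c's0 : 0 <= c' * s by rewrite mulr_ge0// ltW.
pose C := c * s + c' * s + 1.
have C0 : 0 < C by rewrite /C; lra.
have cC : c * s + 1 <= C by rewrite /C; lra.
have c'C : c' * s + 1 <= C by rewrite /C; lra.
pose f := nu (pt 1 0).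
(* The three terms handle, in this order, the heights below W, the height error
   W, and the exclusion of height 0. *)
pose K := 4 * f ^+ 2 / chi + 2 * s / eps + (2 * C / k + 1).
have Ka : 0 <= 4 * f ^+ 2 / chi by rewrite divr_ge0 ?(ltW chi0)// mulr_ge0 ?sqr_ge0.
have Kb : 0 < 2 * s / eps by rewrite divr_gt0 ?mulr_gt0.
have Kc : 0 < 2 * C / k by rewrite divr_gt0 ?mulr_gt0.
have K0 : 0 <= K by rewrite /K; lra.
have DR1 : 1 <= D%:~R :> R by rewrite ler1z -gtz0_ge1.
have N1 : 1 <= (den r)%:~R :> R by rewrite ler1z -gtz0_ge1; case: rr.
have [r' [n [Z [W [[red dx dy] [n1 Kn W0 KW] [ZL ZU NZ ZD] [v1 [v2 V]] [lat lat']]]]]] :=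
  approximating_lattice nu_norm D a1 a2 u w s eps C K D0 uw s1 eps0 C0 K0 r d rr d0.
clear K0.
have n0 : 0 < n by exact: lt_le_trans ltr01 n1.
have Z0 : 0 < Z by rewrite -(pmulr_rgt0 _ s0) (lt_le_trans _ ZL)// exprn_gt0.
have ZleP : Z <= (den r')%:~R by rewrite -ZD ler_peMr// ltW.
have W2 (x : R) : x <= K -> x * W <= n ^+ 2.
  by move=> xK; rewrite (le_trans _ KW)// ler_pM2r.
have sW : 2 * (s * W) <= eps * n ^+ 2.
  have : 2 * s / eps * W <= n ^+ 2 by apply: W2; rewrite /K; lra.
  rewrite -(ler_pM2l eps0) (_ : eps * (2 * s / eps * W) = 2 * (s * W))//.
  by field; rewrite gt_eqF.
have Ck : 2 * C < k * n.
  have : 2 * C / k < n by rewrite (lt_le_trans _ Kn)// /K; lra.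
  by rewrite ltr_pdivrMr// [n * k]mulrC.
have fW : 4 * f ^+ 2 * W <= chi * n ^+ 2.
  have : 4 * f ^+ 2 / chi * W <= n ^+ 2 by apply: W2; rewrite /K; lra.
  rewrite -(ler_pM2l chi0) (_ : chi * (4 * f ^+ 2 / chi * W) = 4 * f ^+ 2 * W)//.
  by field; rewrite gt_eqF.
exists r'; split => //.
  rewrite -(ler_int R) intrM (le_trans _ ZleP)//.
clear KW Kn Ka Kb Kc W2.
split.
- move=> t Nt tP; have [tW|Wt] := ltP t W.
    (* Below W the denominator of the old point is a good enough multiple. *)
    exists (den r), v1, v2; split => //; first by case: rr.
    move: V; set E := err _ _ _ _ _ _ => V.
    have E0 : 0 <= E by exact: norm_ge0.
    have f0 : 0 <= f by exact: norm_ge0.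
    have V2 : n ^+ 2 * E ^+ 2 <= 2 ^+ 2 * f ^+ 2.
      rewrite -!exprMn ler_sqr ?nnegrE ?mulr_ge0 ?(ltW n0)//.
      by rewrite (le_trans V)// ler_wpM2r//; move: eps4; lra.
    have H2 : t * (n ^+ 2 * E ^+ 2) <= W * (2 ^+ 2 * f ^+ 2).
      by rewrite ler_pM ?(ltW tW) ?mulr_ge0 ?sqr_ge0//; move: Nt N1; lra.
    have : n ^+ 2 * (t * E ^+ 2) <= n ^+ 2 * chi by move: fW H2; lra.
    by rewrite ler_pM2l ?exprn_gt0.
  exact: (window_upper nu_norm k0 kP s0 n0 W0 eps0 eps4 ZL sW c' chi t
    ZU Ck c'0 c'C highE Hshallow lat Wt).
exists (Z * j.+1%:R * (1 - eps)).
have jD := deep_index_bound _ _ _ _ _ _ D0 cs0 Hdeep.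
split.
- have H1 : Z * 1 <= Z * j.+1%:R by rewrite ler_pM2l// ler1n.
  have H2 : Z * j.+1%:R * 2^-1 <= Z * j.+1%:R * (1 - eps).
    by rewrite ler_pM2l ?mulr_gt0//; move: eps4; lra.
  by move: NZ H1 H2; lra.
- rewrite -ZD (@le_trans _ _ (Z * j.+1%:R))//; last by rewrite ler_pM2l.
  by rewrite ler_piMr ?mulr_ge0 ?(ltW Z0)//; move: eps0; lra.
exact: (window_lower nu_norm s0 n0 eps0 eps4 ZL sW c clo j _
   c0 cC lowE Hdeep lat' erefl).
Qed.

End WindowStep.

(** * The limit of nested windows *)

Lemma sqr_perturb {R : realType} (A B : R) : 0 <= A < B ->
  exists2 eta : R, 0 < eta & forall t a b : R, 0 <= t -> 
    t * a ^+ 2 <= A -> t * b ^+ 2 <= eta -> t * (a + b) ^+ 2 <= B.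
Proof.
move=> /andP[A0 AB]; pose h := (B - A) / (2 * (A + 1)).
have h0 : 0 < h by rewrite divr_gt0//; lra.
have hA : h * (2 * (A + 1)) = B - A by rewrite divfK// gt_eqF//; lra.
clearbody h.
pose eta := (B - A) * h / (2 * (1 + h)).
have eta0 : 0 < eta by rewrite divr_gt0// mulr_gt0//; lra.
have etah : eta * (2 * (1 + h)) = (B - A) * h.
  by rewrite /eta divfK// gt_eqF// mulr_gt0//; lra.
clearbody eta.
exists eta => // t a b t0 tA tb.
have sq : 0 <= t * (h * a - b) ^+ 2 by rewrite mulr_ge0 ?sqr_ge0.
have H1 : (h + h * h) * (t * a ^+ 2) <= (h + h * h) * A.
  by rewrite ler_wpM2l// addr_ge0 ?mulr_ge0// ltW.
have H2 : (1 + h) * (t * b ^+ 2) <= (1 + h) * eta.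
  by rewrite ler_wpM2l//; lra.
have : h * (t * (a + b) ^+ 2) <= (h + h * h) * A + (1 + h) * eta by lra.
have H3 : (h + h * h) * A + (1 + h) * eta <= h * B.
  have : h * (h * A) <= h * ((B - A) / 2).
    by rewrite ler_pM2l//; lra.
  lra.
by move=> /le_trans/(_ H3); rewrite ler_pM2l.
Qed.

Lemma nested_intervals {R : realType} (a b : nat -> R) :
  (forall i, a i <= a i.+1) -> (forall i, b i.+1 <= b i) -> (forall i, a i <= b i) ->
  exists x, forall i, a i <= x <= b i.
Proof.
move=> a_incr b_decr ab.
have /nondecreasing_seqP a_mono := a_incr.
have /nonincreasing_seqP b_mono := b_decr.
have a_le_b i j : a i <= b j.
  apply: (@le_trans _ _ (a (maxn i j))); first by apply: a_mono; rewrite leq_maxl.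
  by apply: (le_trans (ab _)); apply: b_mono; rewrite leq_maxr.
exists (sup (range a)) => i; apply/andP; split.
  by apply: ub_le_sup; [exists (b 0%N) => _ [j _ <-]|exists i].
by apply: ge_sup; [exists (a 0%N); exists 0%N|move=> _ [j _ <-]].
Qed.

Section NestedWindows.
Context {R : realType} {nu : 'rV[R]_2 -> R} (nu_norm : is_norm nu).

Lemma err_shift (x y x' y' h : R) (q p1 p2 : int) (t : R) :
  0 < q -> q%:~R <= t -> `|x - x'| <= h -> `|y - y'| <= h ->
  err nu x y q p1 p2 <= err nu x' y' q p1 p2 + t * (h * (nu (pt 1 0) + nu (pt 0 1))).
Proof.
move=> q0 qt hx hy; rewrite /err.
apply: (le_trans (norm_le_sub nu_norm _ _ (q%:~R * x' - p1%:~R) (q%:~R * y' - p2%:~R))).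
rewrite lerD2l.
have -> : q%:~R * x - p1%:~R - (q%:~R * x' - p1%:~R) = q%:~R * (x - x') by ring.
have -> : q%:~R * y - p2%:~R - (q%:~R * y' - p2%:~R) = q%:~R * (y - y') by ring.
have q0R : 0 < q%:~R :> R by rewrite ltr0z.
rewrite norm_scale2// gtr0_norm// ler_pM ?norm_ge0 ?(ltW q0R)//.
rewrite (le_trans (norm_le_coord nu_norm _ _))// mulrDr lerD// ler_wpM2r ?norm_ge0//.
Qed.

(** The displacements are at most d / (2 N^2), where N is the current denominator,
and denominators at least double. So the limit stays within d / N^2 of each point
of the sequence, and replacing that point with the limit alters sqrt t * err by
at most sqrt N * N * d / N^2 <= d over its window, up to a constant factor. Since
the windows cover [1, +oo), the bounds for the windows pass to the limsup. *)
Lemma nested_windows (lo clo chi hi : R) :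
  0 < lo < clo -> 0 <= chi < hi ->
  (forall (r : rational_pt) (d : R), reduced r -> 0 < d ->
    exists r' : rational_pt, [/\ reduced r', 2 * den r <= den r',
      `|xcoord r' - xcoord r| <= d / (2 * (den r)%:~R ^+ 2) /\
      `|ycoord r' - ycoord r| <= d / (2 * (den r)%:~R ^+ 2) &
      window (nu := nu) r r' clo chi]) ->
  exists v, (lo%:E <= dirichlet_const nu v)%E /\ (dirichlet_const nu v <= hi%:E)%E.
Proof.
move=> /andP[lo0 loclo] chihi step.
have [eta1 eta10 H1] := sqr_perturb chi hi chihi.
have lomid : 0 <= lo < (lo + clo) / 2 by apply/andP; split; lra.
have [eta2 eta20 H2] := sqr_perturb lo _ lomid.
pose eta := Order.min eta1 eta2.
have eta0 : 0 < eta by rewrite lt_min eta10.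
pose F := nu (pt 1 0) + nu (pt 0 1).
have F0 : 0 <= F by rewrite addr_ge0 ?norm_ge0.
(* The choice ensures (d * F)^2 <= eta. *)
pose d := Order.min 1 (eta / (F + 1) ^+ 2).
have d0 : 0 < d by rewrite lt_min ltr01 divr_gt0// exprn_gt0//; lra.
have d1 : d <= 1 by rewrite ge_min lexx.
have dF : (d * F) ^+ 2 <= eta.
  have : d * (F + 1) ^+ 2 <= eta.
    by rewrite -ler_pdivlMr ?exprn_gt0//; [rewrite ge_min lexx orbT|lra].
  apply: le_trans; rewrite exprMn expr2 -mulrA ler_pM2l//.
  have : d * F ^+ 2 <= 1 * F ^+ 2 by rewrite ler_wpM2r ?sqr_ge0.
  by nra.
pose T := {r : rational_pt | reduced r}.
pose Q (r r' : T) := let r := sval r in let r' := sval r' in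
  [/\ 2 * den r <= den r',
      `|xcoord r' - xcoord r| <= d / (2 * (den r)%:~R ^+ 2) /\
      `|ycoord r' - ycoord r| <= d / (2 * (den r)%:~R ^+ 2) &
      window (nu := nu) r r' clo chi].
have Qex (r : T) : {r' : T | Q r r'}.
  apply: cid; case: r => r rr; have [r' [rr' h1 h2 h3]] := step r d rr d0.
  by exists (exist _ r' rr'); split.
have r0 : reduced (RationalPt 1 0 0 0 (-1)) by [].
have [g [g0 gS]] := dependent_choice Qex (exist _ _ r0).
pose N i : R := (den (sval (g i)))%:~R.
pose x i : R := xcoord (sval (g i)); pose y i : R := ycoord (sval (g i)).
have NS i : 2 * N i <= N i.+1.
  by case: (gS i) => + _ _; rewrite /N -(ler_int R) intrM.
have N0 : N 0%N = 1 by rewrite /N g0.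
have Ni i : i.+1%:R <= N i.
  elim: i => [|i IH]; first by rewrite N0.
  have := NS i; rewrite -natr1; have : 1 <= i.+1%:R :> R by rewrite ler1n.
  move: IH; lra.
have N_gt0 i : 0 < N i by rewrite (lt_le_trans _ (Ni i))// ltr0n.
have close (z : nat -> R) : (forall i, `|z i.+1 - z i| <= d / (2 * N i ^+ 2)) ->
    exists l, forall i, `|l - z i| <= d / N i ^+ 2.
  move=> zS.
  have half i : d / (2 * N i ^+ 2) + d / N i.+1 ^+ 2 <= d / N i ^+ 2.
    have : d / N i.+1 ^+ 2 <= d / (2 * N i ^+ 2).
      rewrite ler_pM2l// lef_pV2 ?posrE ?mulr_gt0 ?exprn_gt0//.
      have : (2 * N i) ^+ 2 <= N i.+1 ^+ 2.
        by rewrite ler_sqr ?nnegrE ?mulr_ge0// ltW// N_gt0.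
      have : 0 < N i ^+ 2 by rewrite exprn_gt0.
      by rewrite exprMn; lra.
    have -> : d / N i ^+ 2 = d / (2 * N i ^+ 2) + d / (2 * N i ^+ 2).
      by field; rewrite gt_eqF ?N_gt0.
    lra.
  have bound i : z i.+1 - z i <= d / (2 * N i ^+ 2) /\ z i - z i.+1 <= d / (2 * N i ^+ 2).
    by have := zS i; rewrite ler_norml => /andP[]; split; lra.
  have [l Hl] : exists l, forall i, z i - d / N i ^+ 2 <= l <= z i + d / N i ^+ 2.
    apply: (nested_intervals (fun i => z i - d / N i ^+ 2) (fun i => z i + d / N i ^+ 2)) => i.
    - by have := half i; have [] := bound i; lra.
    - by have := half i; have [] := bound i; lra.
    - rewrite lerD2l -subr_ge0 opprK.
      by rewrite addr_ge0// divr_ge0 ?ltW// exprn_gt0.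
  by exists l => i; have := Hl i; rewrite ler_norml => /andP[]; rewrite lerBrDl lerBlDl; lra.
have [l1 Hl1] := close x (fun i => let: And3 _ (conj h _) _ := gS i in h).
have [l2 Hl2] := close y (fun i => let: And3 _ (conj _ h) _ := gS i in h).
have small i t : t <= N i -> 0 <= t -> t * (t * (d / N i ^+ 2 * F)) ^+ 2 <= eta.
  move=> tN t0; have NN := N_gt0 i; have N1 : 1 <= N i by rewrite (le_trans _ (Ni i))// ler1n.
  have -> : t * (t * (d / N i ^+ 2 * F)) ^+ 2 = (t * (t / N i ^+ 2) ^+ 2) * (d * F) ^+ 2.
    by field; rewrite gt_eqF.
  apply: (le_trans _ dF); rewrite ler_piMl ?sqr_ge0//.
  apply: (@le_trans _ _ (N i * (N i / N i ^+ 2) ^+ 2)).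
    have tN2 : 0 <= t / N i ^+ 2 by rewrite divr_ge0// sqr_ge0.
    apply: ler_pM => //; first exact: sqr_ge0.
    by rewrite ler_sqr ?nnegrE// ?(le_trans tN2)// ler_pM2r ?invr_gt0 ?exprn_gt0.
  have -> : N i * (N i / N i ^+ 2) ^+ 2 = (N i)^-1 by field; rewrite gt_eqF.
  by rewrite invf_le1.
have eta_le1 : eta <= eta1 by rewrite ge_min lexx.
have eta_le2 : eta <= eta2 by rewrite ge_min lexx orbT.
exists (pt l1 l2); split.
- apply: le_dirichlet_const => B.
  pose i := Num.truncn B.
  have Bi : B < N i by rewrite (lt_le_trans (truncnS_gt B))// Ni.
  case: (gS i) => _ _ [_ [t [it ti Ht]]].
  have Bt : B < t by exact: lt_le_trans it.
  have t0 : 0 < t by rewrite (lt_le_trans (N_gt0 i)).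
  have t1 : 1 <= t by rewrite (le_trans _ it)// (le_trans _ (Ni i))// ler1n.
  exists t => //.
  have lot : 0 <= lo / t by rewrite divr_ge0// ltW.
  suff H : Num.sqrt (lo / t) <= min_dist nu (pt l1 l2) t.
    have : Num.sqrt (lo / t) ^+ 2 <= min_dist nu (pt l1 l2) t ^+ 2.
      by rewrite ler_sqr// nnegrE ?sqrtr_ge0// min_dist_ge0.
    by rewrite sqr_sqrtr// ler_pdivrMr// mulrC.
  apply: le_min_dist => // q p1 p2 q0 qt.
  rewrite leNgt; apply/negP => Hlt.
  have E0 : 0 <= err nu l1 l2 q p1 p2 by exact: err_ge0.
  have : t * err nu l1 l2 q p1 p2 ^+ 2 <= lo.
    have : err nu l1 l2 q p1 p2 ^+ 2 <= Num.sqrt (lo / t) ^+ 2.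
      by rewrite ler_sqr ?nnegrE ?sqrtr_ge0// ltW.
    by rewrite sqr_sqrtr// ler_pdivlMr// mulrC.
  move=> Elo; have sm := small i.+1 t ti (ltW t0).
  move: (H2 _ _ _ (ltW t0) Elo (le_trans sm eta_le2)).
  apply/negP; rewrite -ltNge.
  have H3 := Ht q p1 p2 q0 qt.
  apply: (@lt_le_trans _ _ clo); first lra.
  apply: (le_trans H3); rewrite ler_pM2l// ler_sqr ?nnegrE ?err_ge0//; last first.
    by rewrite addr_ge0 ?err_ge0// !mulr_ge0 ?invr_ge0 ?sqr_ge0 ?(ltW t0) ?(ltW d0).
  by apply: err_shift => //; rewrite distrC; [exact: Hl1|exact: Hl2].
- apply: (@dirichlet_const_le _ _ _ _ 1) => t t1.
  have t0 : 0 <= t by rewrite (le_trans ler01).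
  have [i [it ti]] : exists i, N i <= t /\ t <= N i.+1.
    have ex : exists i, t < N i.
      by exists (Num.truncn t); rewrite (lt_le_trans (truncnS_gt t))// Ni.
    case: (ex_minnP ex) => -[|i] ti min; first by move: ti; rewrite N0 ltNge t1.
    by exists i; split; [rewrite leNgt; apply/negP => /min; rewrite ltnn|exact: ltW].
  case: (gS i) => _ _ [/(_ t it ti)[q [p1 [p2 [q0 qt Eq]]]] _].
  have sm := small i.+1 t ti t0.
  apply: (le_trans _ (H1 _ _ _ t0 Eq (le_trans sm eta_le1))).
  rewrite ler_wpM2l// ler_sqr ?nnegrE ?min_dist_ge0//; last first.
    by rewrite addr_ge0 ?err_ge0// !mulr_ge0 ?invr_ge0 ?sqr_ge0 ?(ltW d0).
  by apply: (le_trans (min_dist_le nu_norm _ _ _ _ p1 p2 q0 qt)); apply: err_shift => //;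
    [exact: Hl1|exact: Hl2].
Qed.

End NestedWindows.

(** * Dirichlet's theorem *)

Section DirichletTheorem.
Context {R : realType} {nu : 'rV[R]_2 -> R} (nu_norm : is_norm nu).

Definition cell (n : nat) (z : R) : 'I_n.+1 :=
  inord (Num.truncn (n.+1%:R * (z - (Num.floor z)%:~R))).

Lemma frac_itv (z : R) : 0 <= z - (Num.floor z)%:~R < 1.
Proof.
have /andP[] := floor_itv z; rewrite intrD => z1 z2.
by rewrite subr_ge0 z1 ltrBlDl.
Qed.

Lemma cell_close (n : nat) (z z' : R) : cell n z = cell n z' ->
  `|(z - (Num.floor z)%:~R) - (z' - (Num.floor z')%:~R)| <= n.+1%:R^-1.
Proof.
rewrite /cell; have := frac_itv z; have := frac_itv z'.
set a := z - _; set b := z' - _ => /andP[b0 b1] /andP[a0 a1].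
have n0 : 0 < n.+1%:R :> R by rewrite ltr0n.
have trn (y : R) : 0 <= y -> y < 1 -> (Num.truncn (n.+1%:R * y) < n.+1)%N.
  move=> y0 y1; rewrite truncn_lt_nat ?mulr_ge0 ?(ltW n0)//.
  by rewrite -[ltRHS]mulr1 ltr_pM2l.
move=> /(congr1 val); rewrite !val_insubd !trn// => ab.
have /andP[a2 a3] := truncn_itv (mulr_ge0 (ltW n0) a0).
have /andP[b2 b3] := truncn_itv (mulr_ge0 (ltW n0) b0).
rewrite ab in a2 a3; have S := @natr1 R (Num.truncn (n.+1%:R * b)).
rewrite -S in a3 b3.
rewrite -(ler_pM2l n0) mulfV ?gt_eqF// -{1}(gtr0_norm n0) -normrM ler_norml mulrBr.
by apply/andP; split; lra.
Qed.

(** Pigeonhole: n'^2 + 1 multiples of (x, y), with n' = n + 1, fall into n'^2 cells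
of the unit torus. *)
Lemma dirichlet_theorem (n : nat) (x y : R) : exists q p1 p2 : int,
  [/\ 0 < q, q%:~R <= n.+1%:R ^+ 2 :> R &
    `|q%:~R * x - p1%:~R| <= n.+1%:R^-1 /\ `|q%:~R * y - p2%:~R| <= n.+1%:R^-1].
Proof.
pose f (q : 'I_(n.+1 * n.+1).+1) := (cell n (q%:R * x), cell n (q%:R * y)).
have : ~~ injectiveb f.
  apply/negP => /injectiveP/leq_card; rewrite card_prod !card_ord.
  by rewrite ltnn.
move=> /injectivePn[q1 [q2 q12 fq]].
wlog lt12 : q1 q2 q12 fq / (q2 < q1)%N.
  move=> W; have [lt|] := ltnP q2 q1; first exact: (W q1 q2).
  rewrite leq_eqVlt => /orP[/eqP/val_inj e|lt]; first by rewrite e eqxx in q12.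
  by apply: (W q2 q1) => //; rewrite eq_sym.
case: fq => /cell_close cx /cell_close cy.
exists (q1%:Z - q2%:Z), (Num.floor (q1%:R * x) - Num.floor (q2%:R * x)),
  (Num.floor (q1%:R * y) - Num.floor (q2%:R * y)).
split.
- by rewrite subr_gt0 ltz_nat.
- rewrite intrB -natrX lerBlDr (@le_trans _ _ (n.+1 ^ 2)%:R) ?lerDl//.
  by rewrite -[_%:~R]/(q1%:R : R) ler_nat -ltnS -mulnn ltn_ord.
- split.
    apply: le_trans cx; rewrite le_eqVlt; apply/orP; left; apply/eqP.
    by congr `|_|; rewrite !intrB; ring.
  apply: le_trans cy; rewrite le_eqVlt; apply/orP; left; apply/eqP.
  by congr `|_|; rewrite !intrB; ring.
Qed.

(** Apply the previous lemma with n + 1 the integer part of sqrt t. *)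
Lemma min_dist_bound : exists2 C : R, 0 < C & forall x y t, 1 <= t ->
  t * min_dist nu (pt x y) t ^+ 2 <= C.
Proof.
pose F := nu (pt 1 0) + nu (pt 0 1).
have F0 : 0 <= F by rewrite addr_ge0 ?norm_ge0.
exists (4 * F ^+ 2 + 1) => [|x y t t1]; first by have := sqr_ge0 F; lra.
have t0 : 0 <= t by rewrite (le_trans ler01).
pose n := Num.truncn (Num.sqrt t).
have st : Num.sqrt t ^+ 2 = t by rewrite sqr_sqrtr.
have s1 : 1 <= Num.sqrt t by rewrite -sqrtr1 ler_sqrt.
have := truncn_itv (le_trans ler01 s1); rewrite -/n => /andP[n1 n2].
have : (0 < n)%N by rewrite truncn_gt0.
case: n n1 n2 => // n n1 n2 _.
have n0 : 0 < n.+1%:R :> R by rewrite ltr0n.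
have n11 : 1 <= n.+1%:R :> R by rewrite ler1n.
have [q [p1 [p2 [q0 qn [hx hy]]]]] := dirichlet_theorem n x y.
have nt : n.+1%:R ^+ 2 <= t by rewrite -st ler_sqr ?nnegrE ?sqrtr_ge0 ?ler0n.
have md : min_dist nu (pt x y) t <= n.+1%:R^-1 * F.
  apply: (le_trans (min_dist_le nu_norm _ _ _ _ p1 p2 q0 (le_trans qn nt))).
  rewrite /err (le_trans (norm_le_coord nu_norm _ _))// mulrDr.
  by rewrite lerD// ler_wpM2r// norm_ge0.
have tn : t <= 4 * n.+1%:R ^+ 2.
  have -> : 4 * n.+1%:R ^+ 2 = (2 * n.+1%:R) ^+ 2 :> R by ring.
  rewrite -st ler_sqr ?nnegrE ?sqrtr_ge0 ?mulr_ge0//.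
  rewrite -natr1 in n2; lra.
have md2 : min_dist nu (pt x y) t ^+ 2 <= (n.+1%:R^-1 * F) ^+ 2.
  by rewrite ler_sqr ?nnegrE ?min_dist_ge0 ?mulr_ge0.
apply: (@le_trans _ _ (4 * n.+1%:R ^+ 2 * (n.+1%:R^-1 * F) ^+ 2)).
  by apply: ler_pM => //; exact: sqr_ge0.
have -> : 4 * n.+1%:R ^+ 2 * (n.+1%:R^-1 * F) ^+ 2 = 4 * F ^+ 2.
  by field; rewrite gt_eqF.
by rewrite lerDl.
Qed.

End DirichletTheorem.

(** * Tuning the value of a model *)

Section Spectrum.
Context {R : realType} {nu : 'rV[R]_2 -> R} (nu_norm : is_norm nu).

(** Decreasing the stretching factor by 1 + h moves the vector by h times its second
coordinate, which its norm controls. *)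
Lemma model_norm_stretch (k : R) (D a1 a2 : int) (s h : R) (m1 m2 m3 : int) :
  0 < k -> (forall a b, k * (`|a| + `|b|) <= nu (pt a b)) -> 0 < s -> 0 <= h ->
  model_norm (nu := nu) D a1 a2 s m1 m2 m3 <=
    (1 + h * (nu (pt 0 1) / k)) * model_norm (nu := nu) D a1 a2 ((1 + h) * s) m1 m2 m3.
Proof.
move=> k0 kP s0 h0; rewrite /model_norm; set v1 := lat1 _ _ _ _; set v2 := lat2 _ _ _ _.
set M := nu (pt v1 ((1 + h) * s * v2)).
apply: (le_trans (norm_le_sub nu_norm _ _ v1 ((1 + h) * s * v2))).
rewrite -/M [leRHS]mulrDl mul1r lerD2l subrr.
have -> : s * v2 - (1 + h) * s * v2 = - (h * (s * v2)) by ring.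
rewrite (le_trans (norm_le_coord nu_norm _ _))// normr0 mul0r add0r normrN.
rewrite normrM (ger0_norm h0).
have H : `|s * v2| <= M / k.
  rewrite ler_pdivlMr// mulrC (le_trans _ (kP _ _))// ler_pM2l//.
  apply: (@le_trans _ _ `|(1 + h) * s * v2|); last by rewrite lerDr.
  by rewrite -mulrA [leRHS]normrM ler_peMl// ger0_norm; lra.
have -> : h * (nu (pt 0 1) / k) * M = h * (M / k) * nu (pt 0 1).
  by field; rewrite gt_eqF.
by rewrite ler_wpM2r ?norm_ge0// ler_wpM2l.
Qed.

Lemma bernoulli_le (h : R) (i : nat) : 0 <= h -> i%:R * h <= (1 + h) ^+ i.
Proof.
move=> h0; elim: i => [|i IH]; first by rewrite mul0r expr0.
have H1 : 1 <= (1 + h) ^+ i by rewrite exprn_ege1//; lra.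
rewrite exprSr -natr1; have : h * 1 <= h * (1 + h) ^+ i by rewrite ler_wpM2l.
lra.
Qed.

(** The vector (1, 0) has a norm independent of s, and j is at most D. *)
Lemma deep_bounded (D a1 a2 : int) (s c : R) : 0 < D -> 0 < c -> 0 < s ->
  deep (nu := nu) D a1 a2 s c -> c * s <= D%:~R * nu (pt 1 0) ^+ 2.
Proof.
move=> D0 c0 s0 [j Hj]; have cs0 : 0 < c * s by rewrite mulr_gt0.
have jD := deep_index_bound nu_norm _ _ _ _ _ _ D0 cs0 Hj.
have m0 : (1 : int, 0 : int, 0 : int) != (0, 0, 0) by [].
rewrite (le_trans (Hj 1 0 0 m0 _))// /model_norm /lat1 /lat2.
by rewrite !mul0r !addr0 mulr0 ler_wpM2r// sqr_ge0.
Qed.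

(** A discrete intermediate value argument along s = (1 + h)^i: at the last i where
the model is deep, the next one is not, and the two differ by a factor close
to 1. *)
Lemma exists_deep_shallow (D a1 a2 : int) (c chi : R) : 0 < D -> 0 < c < chi ->
  deep (nu := nu) D a1 a2 1 c ->
  exists s c' : R, [/\ 1 <= s, 0 <= c' < chi, deep (nu := nu) D a1 a2 s c &
    shallow (nu := nu) D a1 a2 s c'].
Proof.
move=> D0 /andP[c0 cchi] deep1; have [k k0 kP] := norm_ge_coord nu_norm.
pose g := nu (pt 0 1) / k.
have g0 : 0 <= g by apply: divr_ge0; [exact: norm_ge0|exact: ltW].
(* (1 + e)^3 <= 1 + 7 e < chi / c is what is needed. *)
pose e := Order.min 1 ((chi - c) / (14 * c)).
have e0 : 0 < e by rewrite lt_min ltr01 divr_gt0//; lra.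
have e1 : e <= 1 by rewrite ge_min lexx.
have e2 : e * (14 * c) <= chi - c.
  by rewrite -ler_pdivlMr ?ge_min ?lexx ?orbT//; lra.
pose h := e / (1 + g).
have hg : h * (1 + g) = e by rewrite divfK// gt_eqF//; lra.
have h0 : 0 < h by rewrite divr_gt0//; lra.
clearbody h e.
pose c' := c * ((1 + h) * (1 + h * g) ^+ 2).
have hg0 : 0 <= h * g by rewrite mulr_ge0// ltW.
have c'0 : 0 <= c'.
  by apply: mulr_ge0; [exact: ltW|apply: mulr_ge0; [lra|exact: sqr_ge0]].
have c'chi : c' < chi.
  have : (1 + h) * (1 + h * g) ^+ 2 <= (1 + e) * (1 + e) ^+ 2.
    apply: ler_pM; rewrite ?sqr_ge0 ?addr_ge0 ?(ltW h0)//; first by rewrite lerD2l; lra.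
    by rewrite ler_sqr ?nnegrE ?addr_ge0 ?(ltW e0)//; lra.
  have : (1 + e) * (1 + e) ^+ 2 <= 1 + 7 * e.
    have ee : e * e <= 1 * e by rewrite ler_pM2r.
    have eee : e * (e * e) <= e * (1 * e) by rewrite ler_pM2l.
    have -> : (1 + e) * (1 + e) ^+ 2 = 1 + 3 * e + 3 * (e * e) + e * (e * e) by ring.
    lra.
  move=> /[swap] /le_trans /[apply]; rewrite -(ler_pM2l c0) -/c' => H.
  by apply: (le_lt_trans H); lra.
have ex : exists i, ~~ `[< deep (nu := nu) D a1 a2 ((1 + h) ^+ i) c >].
  pose B := D%:~R * nu (pt 1 0) ^+ 2 / (c * h).
  exists (Num.truncn B).+1; apply/asboolPn => dp.
  have p0 : 0 < (1 + h) ^+ (Num.truncn B).+1 by rewrite exprn_gt0//; lra.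
  have := deep_bounded _ _ _ _ _ D0 c0 p0 dp; apply/negP; rewrite -ltNge.
  have := truncnS_gt B; rewrite ltr_pdivrMr ?mulr_gt0// => /lt_le_trans; apply.
  by rewrite mulrCA ler_pM2l// bernoulli_le// ltW.
case: (ex_minnP ex) => -[|i] ndeep min.
  by move/asboolPn: ndeep; rewrite expr0.
have dp : deep (nu := nu) D a1 a2 ((1 + h) ^+ i) c.
  by apply: contrapT => nd; have := min i; rewrite ltnn => H; suff: false by []; apply: H; apply/asboolPn.
exists ((1 + h) ^+ i), c'; split => //.
- by rewrite exprn_ege1//; lra.
- by rewrite c'0.
move=> j; apply: contrapT => nsh; move/asboolPn: ndeep; apply.
exists j => m1 m2 m3 m0 m3j; rewrite leNgt; apply/negP => lt.
apply: nsh; exists m1, m2, m3; split => //.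
have s0 : 0 < (1 + h) ^+ i by rewrite exprn_gt0//; lra.
have := model_norm_stretch k D a1 a2 _ h m1 m2 m3 k0 kP s0 (ltW h0).
have sS : (1 + h) ^+ i.+1 = (1 + h) * (1 + h) ^+ i by rewrite exprS.
rewrite -/g; rewrite sS in lt; move: lt.
set s := (1 + h) ^+ i in s0 *; set M := model_norm _ _ _ _ _ _ _; set M' := model_norm _ _ _ _ _ _ _.
move=> lt MM.
have MM2 : M' ^+ 2 <= (1 + h * g) ^+ 2 * M ^+ 2.
  have g1 : 0 <= 1 + h * g by rewrite addr_ge0.
  by rewrite -exprMn ler_sqr ?nnegrE//; [exact: norm_ge0|rewrite mulr_ge0// norm_ge0].
apply: (@le_trans _ _ (j.+1%:R * ((1 + h * g) ^+ 2 * M ^+ 2))).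
  by rewrite ler_pM2l ?ltr0n.
rewrite mulrCA; apply: (@le_trans _ _ ((1 + h * g) ^+ 2 * (c * ((1 + h) * s)))).
  by rewrite ler_wpM2l ?sqr_ge0// ltW.
by rewrite /c' le_eqVlt; apply/orP; left; apply/eqP; ring.
Qed.

End Spectrum.

(** * The top of the spectrum *)

Section Corollary.
Context {R : realType} {nu : 'rV[R]_2 -> R} (nu_norm : is_norm nu).

Lemma model_normE (D a1 a2 m1 m2 m3 : int) :
  model_norm (nu := nu) D a1 a2 1 m1 m2 m3 =
    err nu (a1%:~R / D%:~R) (a2%:~R / D%:~R) m3 (- m1) (- m2).
Proof.
rewrite /model_norm /err /lat1 /lat2 mul1r.
by congr (nu (pt _ _)); rewrite mulrNz opprK addrC mulrA.
Qed.

(** With D = K^2, a1 = 1 + K c and a2 = K d, the identity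
(1 - K c) (1 + K c) + c^2 K^2 = 1 is a Bezout relation for every c, so that c and d
are free for the approximation. *)
Lemma square_denominator_approx (x y h : R) : 0 < h -> exists D a1 a2 u w : int,
  [/\ 0 < D, u * a1 + w * D = 1,
    `|x - a1%:~R / D%:~R| <= h & `|y - a2%:~R / D%:~R| <= h].
Proof.
move=> h0; pose K : int := Num.floor (2 / h) + 1.
have K0 : 0 < K by rewrite /K ltzD1 floor_ge0 divr_ge0// ltW.
have K1 : 1 <= K%:~R :> R by rewrite ler1z -gtz0_ge1.
have KR0 : 0 < K%:~R :> R by rewrite ltr0z.
have Kh : 2 < h * K%:~R.
  by rewrite mulrC -ltr_pdivrMr//; have /andP[] := floor_itv (2 / h).
pose c := Num.floor (K%:~R * x); pose d := Num.floor (K%:~R * y).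
have /andP[c1 c2] := floor_itv (K%:~R * x).
have /andP[d1 d2] := floor_itv (K%:~R * y).
rewrite -/c intrD in c1 c2; rewrite -/d intrD in d1 d2; clearbody c d K.
exists (K * K), (1 + K * c), (K * d), (1 - K * c), (c * c); split.
- by rewrite mulr_gt0.
- by ring.
- rewrite -(ler_pM2l (mulr_gt0 KR0 KR0)) -{1}(gtr0_norm (mulr_gt0 KR0 KR0)) -normrM.
  have -> : K%:~R * K%:~R * (x - (1 + K * c)%:~R / (K * K)%:~R) =
      K%:~R * (K%:~R * x - c%:~R) - 1.
    by rewrite intrD !intrM; field; rewrite gt_eqF.
  have A : 0 <= K%:~R * (K%:~R * x - c%:~R) by rewrite mulr_ge0 ?subr_ge0// ltW.
  have B : K%:~R * (K%:~R * x - c%:~R) <= K%:~R * 1 by rewrite ler_pM2l//; lra.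
  have : K%:~R * 2 <= K%:~R * (h * K%:~R) by rewrite ler_pM2l// ltW.
  by move=> H; rewrite ler_norml; apply/andP; split; lra.
- rewrite -(ler_pM2l (mulr_gt0 KR0 KR0)) -{1}(gtr0_norm (mulr_gt0 KR0 KR0)) -normrM.
  have -> : K%:~R * K%:~R * (y - (K * d)%:~R / (K * K)%:~R) =
      K%:~R * (K%:~R * y - d%:~R).
    by rewrite !intrM; field; rewrite gt_eqF.
  have A : 0 <= K%:~R * (K%:~R * y - d%:~R) by rewrite mulr_ge0 ?subr_ge0// ltW.
  have B : K%:~R * (K%:~R * y - d%:~R) <= K%:~R * 1 by rewrite ler_pM2l//; lra.
  have : K%:~R * 2 <= K%:~R * (h * K%:~R) by rewrite ler_pM2l// ltW.
  by move=> H; rewrite ler_norml; apply/andP; split; lra.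
Qed.

Lemma norm_int_ge (k : R) (m1 m2 : int) :
  (forall a b, k * (`|a| + `|b|) <= nu (pt a b)) -> 0 < k ->
  (m1, m2) != (0, 0) -> k <= nu (pt m1%:~R m2%:~R).
Proof.
move=> kP k0 m0; rewrite (le_trans _ (kP _ _))// ler_peMr ?(ltW k0)//.
rewrite -!intr_norm -intrD -[1]/(1%:~R) ler_int.
have : m1 <> 0 \/ m2 <> 0.
  by have [m10|/eqP] := eqVneq m1 0; [right=> m20; rewrite m10 m20 in m0|left].
by lia.
Qed.

(** Approximate (x, y) by a rational point so closely that nothing changes up to
height t, and take j to be the integer part of t. The model also contains the
vectors of height 0, about which min_dist says nothing; these are integer points
of norm at least k, which is enough for t large since t * min_dist^2 is
bounded. *)
Lemma deep_of_min_dist (c c0 : R) : 0 < c < c0 -> exists T : R, forall x y t,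
  T < t -> c0 < t * min_dist nu (pt x y) t ^+ 2 ->
  exists D a1 a2 u w : int, [/\ 0 < D, u * a1 + w * D = 1 &
    deep (nu := nu) D a1 a2 1 c].
Proof.
move=> /andP[c_gt0 cc0]; have [k k0 kP] := norm_ge_coord nu_norm.
have [C C0 HC] := min_dist_bound nu_norm.
have k20 : 0 < k ^+ 2 by rewrite exprn_gt0.
pose F := nu (pt 1 0) + nu (pt 0 1).
have F0 : 0 <= F by rewrite addr_ge0 ?norm_ge0.
exists (1 + C / k ^+ 2) => x y t Tt Hmd.
have Ck : 0 < C / k ^+ 2 by rewrite divr_gt0.
have t1 : 1 <= t by lra.
have t0 : 0 < t by lra.
have tk : C < t * k ^+ 2 by rewrite -ltr_pdivrMr//; lra.
have c0C : c0 < C by exact: lt_le_trans Hmd (HC x y t t1).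
clear Tt.
set e := min_dist _ _ _ in Hmd.
have e0 : 0 <= e by exact: min_dist_ge0.
pose e' := Num.sqrt (c / t).
have ct : 0 <= c / t by rewrite divr_ge0 ?ltW.
have e'2 : e' ^+ 2 = c / t by rewrite sqr_sqrtr.
have e'0 : 0 <= e' by exact: sqrtr_ge0.
have ee' : e' < e.
  have : e' ^+ 2 < e ^+ 2.
    by rewrite e'2 ltr_pdivrMr// (lt_trans cc0)// mulrC.
  by rewrite ltr_sqr ?nnegrE.
pose h := (e - e') / (t * (F + 1)).
have tF : 0 < t * (F + 1) by rewrite mulr_gt0//; lra.
have h0 : 0 < h by rewrite divr_gt0// subr_gt0.
have hF : t * (h * F) <= e - e'.
  have E : h * (t * (F + 1)) = e - e' by rewrite divfK// gt_eqF.
  rewrite -E; have : h * (t * F) <= h * (t * (F + 1)).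
    by rewrite ler_pM2l// ler_pM2l//; lra.
  by lra.
have [D [a1 [a2 [u [w [D0 uw hx hy]]]]]] := square_denominator_approx x y h h0.
exists D, a1, a2, u, w; split => //.
pose j := Num.truncn t.
have jt : t < j.+1%:R by exact: truncnS_gt.
have jt' : j%:R <= t by rewrite truncn_le ltW.
have far q p1 p2 : 0 < q -> q <= j%:Z ->
    c <= j.+1%:R * err nu (a1%:~R / D%:~R) (a2%:~R / D%:~R) q p1 p2 ^+ 2.
  move=> q0 qj.
  have qt : q%:~R <= t by rewrite (le_trans _ jt')// -[j%:R]/((j%:Z)%:~R) ler_int.
  have H1 : e <= err nu x y q p1 p2 by exact: min_dist_le.
  have H2 := err_shift nu_norm x y _ _ h q p1 p2 t q0 qt hx hy.
  set E := err nu (a1%:~R / D%:~R) (a2%:~R / D%:~R) q p1 p2 in H2 *.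
  have Ee : e' <= E by move: hF; rewrite -/F in H2; lra.
  have -> : c = t * e' ^+ 2 by rewrite e'2 mulrC divfK// gt_eqF.
  apply: ler_pM; rewrite ?sqr_ge0 ?(ltW t0) ?(ltW jt)//.
  by rewrite ler_sqr ?nnegrE// (le_trans e'0).
exists j => m1 m2 m3 m0 m3j; rewrite mulr1 model_normE.
have [m3_gt0|m3_lt0|m30] := ltrgt0P m3.
- by apply: far => //; move: m3j; rewrite gtr0_norm.
- rewrite -err_oppr//; apply: far; first by rewrite oppr_gt0.
  by move: m3j; rewrite ltr0_norm.
rewrite m30 in m0 *; rewrite /err !mul0r !sub0r !mulrNz !opprK.
have kn : k <= nu (pt m1%:~R m2%:~R).
  by apply: norm_int_ge => //; apply: contra m0 => /eqP[-> ->].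
have : t * k ^+ 2 <= j.+1%:R * nu (pt m1%:~R m2%:~R) ^+ 2.
  apply: ler_pM; rewrite ?sqr_ge0 ?(ltW t0) ?(ltW jt)//.
  by rewrite ler_sqr ?nnegrE ?(norm_ge0 nu_norm) ?(ltW k0)//.
by move: tk c0C cc0; lra.
Qed.

Lemma spectrum_between (D a1 a2 u w : int) (c0 lo hi : R) :
  0 < D -> u * a1 + w * D = 1 -> deep (nu := nu) D a1 a2 1 c0 ->
  0 < lo -> lo < c0 -> lo < hi ->
  exists v, (lo%:E <= dirichlet_const nu v)%E /\ (dirichlet_const nu v <= hi%:E)%E.
Proof.
move=> D0 uw [j Hj] lo0 loc0 lohi.
pose M := Order.min c0 hi.
have loM : lo < M by rewrite lt_min loc0.
have Mc0 : M <= c0 by rewrite ge_min lexx.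
have Mhi : M <= hi by rewrite ge_min lexx orbT.
clearbody M.
pose c := (lo + M) / 2; pose clo := (lo + c) / 2; pose chi := (c + M) / 2.
have cd : deep (nu := nu) D a1 a2 1 c.
  exists j => m1 m2 m3 m0 m3j; apply: le_trans (Hj m1 m2 m3 m0 m3j).
  by rewrite !mulr1 /c; lra.
have cchi : 0 < c < chi by apply/andP; rewrite /chi /c; split; lra.
have [s [c' [s1 c'chi sdeep sshallow]]] := exists_deep_shallow nu_norm _ _ _ _ _ D0 cchi cd.
have cloc : 0 < clo < c by apply/andP; rewrite /clo /c; split; lra.
apply: (nested_windows nu_norm lo clo chi hi).
- by apply/andP; rewrite /clo /c; split; lra.
- by apply/andP; rewrite /chi /c; split; lra.
exact: (window_step nu_norm D a1 a2 u w s c c' clo chi D0 uw s1 cloc c'chi sdeep sshallow).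
Qed.

(** For positivity the model Z^2 x Z suffices: at height 0 its vectors are the
integer points. *)
Lemma dirichlet_sup_pos : exists2 c : R, 0 < c & dirichlet_sup nu = c%:E.
Proof.
have [k k0 kP] := norm_ge_coord nu_norm.
have k20 : 0 < k ^+ 2 by rewrite exprn_gt0.
have [C C0 HC] := min_dist_bound nu_norm.
have D1 : deep (nu := nu) 1 0 0 1 (k ^+ 2).
  exists 0%N => m1 m2 m3 m0; rewrite normr_le0 => /eqP m30; subst m3.
  rewrite mulr1 mul1r ler_sqr ?nnegrE ?(norm_ge0 nu_norm) ?(ltW k0)//.
  rewrite /model_norm /lat1 /lat2 !mul0r !addr0 mul1r.
  by apply: norm_int_ge => //; apply: contra m0 => /eqP[-> ->].
have [v [lov _]] := spectrum_between 1 0 0 0 1 (k ^+ 2) (k ^+ 2 / 2) (k ^+ 2)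
  isT erefl D1 ltac:(lra) ltac:(lra) ltac:(lra).
have supC : (dirichlet_sup nu <= C%:E)%E.
  apply: ge_ereal_sup => _ [x _ <-]; rewrite [x]ptE.
  by apply: (@dirichlet_const_le _ _ _ _ 1) => t t1; exact: HC.
have lsup : ((k ^+ 2 / 2)%:E <= dirichlet_sup nu)%E.
  by apply: (le_trans lov); apply: ereal_sup_ubound; exists v.
case: (dirichlet_sup nu) supC lsup => [c||]//.
rewrite !lee_fin => _ kc; exists c => //; lra.
Qed.

End Corollary.

Theorem corollary1p2 (R : realType) (nu : 'rV[R]_2 -> R) (nu_norm : is_norm nu) :
  exists c : R, dirichlet_sup nu = c%:E /\ limit_point (dirichlet_spectrum nu) c.
Proof.
have [c c0 supE] := dirichlet_sup_pos nu_norm.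
exists c; split => // U /nbhs_ballP[e /= e0 eU].
pose lo := Order.max (c / 2) (c - e / 2).
have lo0 : 0 < lo by rewrite lt_max; apply/orP; left; lra.
have loc : lo < c by rewrite gt_max; apply/andP; split; lra.
have loe : c - e / 2 <= lo by rewrite le_max lexx orbT.
clearbody lo.
pose hi := (lo + c) / 2; pose mid := (lo + hi) / 2.
have midhi : 0 < mid < hi by apply/andP; rewrite /mid /hi; split; lra.
have : (hi%:E < dirichlet_sup nu)%E by rewrite supE lte_fin /hi; lra.
move=> /ereal_sup_gt[_ [x _ <-]]; rewrite [x]ptE => hix.
have [T HT] := deep_of_min_dist nu_norm mid hi midhi.
have [t Tt hit] := dirichlet_const_gt _ _ T hix.
have [D [a1 [a2 [u [w [D0 uw deepD]]]]]] := HT _ _ _ Tt hit.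
have [v [lov vhi]] := spectrum_between nu_norm D a1 a2 u w mid lo hi D0 uw deepD lo0
  ltac:(rewrite /mid /hi; lra) ltac:(rewrite /hi; lra).
case E : (dirichlet_const nu v) lov vhi => [r||]//; rewrite !lee_fin => lor rhi.
have rc : r < c by rewrite (le_lt_trans rhi)// /hi; lra.
exists r; split; [by rewrite lt_eqF|by exists v|].
by apply: eU; rewrite /ball /= gtr0_norm ?subr_gt0//; lra.
Qed.
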